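(* Let $(X_1,u_1)$ and $(X_2,u_2)$ be Cantor minimal systems. The following are equivalent: (i) There exists a group embedding $\mathsf{D}(X_1,u_1)\hookrightarrow\mathsf{F}(X_2,u_2)$. (ii) There exists a group embedding $\mathsf{F}(X_1,u_1)\hookrightarrow\mathsf{F}(X_2,u_2)$. (iii) There exists an element $v\in\mathsf{F}(X_2,u_2)$ such that the system $(\mathrm{Supp}(v),v)$ factors onto $(X_1,u_1)$. More precisely, non-trivial group homomorphisms $\rho\colon\mathsf{D}(X_1,u_1)\to\mathsf{F}(X_2,u_2)$ are in one-to-one correspondence with pairs $(v,q)$ consisting of an element $v\in\mathsf{F}(X_2,u_2)$ as in (iii) and a factor map $q\colon\mathrm{Supp}(v)\to X_1$. Such a pair $(v,q)$ gives rise to the homomorphism $\rho\colon\mathsf{D}(X_1,u_1)\to\mathsf{F}(X_2,u_2)$ given by $$\rho(g)(x)=\begin{cases} v^{k_g(q(x))}(x) & \text{if } x\in\mathrm{Supp}(v), \\ x & \text{otherwise,} \end{cases}$$ and conversely every non-trivial homomorphism $\mathsf{D}(X_1,u_1)\to\mathsf{F}(X_2,u_2)$ arises in this way for a unique pair $(v,q)$.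
   Context: A Cantor minimal system $(X,u)$ consists of a space $X$ homeomorphic to the Cantor set and a homeomorphism $u$ of $X$ all of whose orbits are dense. Its topological full group $\mathsf{F}(X,u)$ is the group of all homeomorphisms $g$ of $X$ such that every point of $X$ has a neighbourhood on which $g$ coincides with some power $u^n$, $n\in\mathbb{Z}$; $\mathsf{D}(X,u)$ is its derived (commutator) subgroup. Every $g\in\mathsf{F}(X,u)$ is uniquely determined by its orbit cocycle, the continuous function $k_g\colon X\to\mathbb{Z}$ with $g(x)=u^{k_g(x)}(x)$ for all $x\in X$. The support $\mathrm{Supp}(v)$ of $v\in\mathsf{F}(X,u)$ is the closure of the set of points moved by $v$; it is clopen and $v$-invariant. A factor map from a system $(Y,v)$ onto $(X,u)$ is a continuous surjective map $q\colon Y\to X$ with $u\circ q=q\circ v$; $(Y,v)$ factors onto $(X,u)$ if such a map exists. *)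

(* Defs.v *)
From HB Require Import structures.
From mathcomp Require Import all_boot all_order all_algebra.
From mathcomp Require Import boolp classical_sets functions cardinality topology cantor.

Set Implicit Arguments.
Unset Strict Implicit.
Unset Printing Implicit Defensive.

Local Open Scope classical_set_scope.
Local Open Scope group_scope.

Definition zexpg (G : groupType) (x : G) (n : int) : G :=
  match n with Posz m => x ^+ m | Negz m => x ^- m.+1 end.

Section IntegerPowers.
Variables (G : groupType) (x : G).

Lemma zexpgS (n : int) : zexpg x (n + 1)%R = zexpg x n * x.
Proof.
case: n => [n|[|n]] /=; first by rewrite addn1 expgSr.
  by rewrite expg1 mulVg.
by rewrite -[in RHS]expVgn [in RHS]expgSr mulgVK expVgn subSS subn0.
Qed.

Lemma zexpgD (m n : int) : zexpg x (m + n)%R = zexpg x m * zexpg x n.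
Proof.
elim/int_rect: n => [|n IHn|n IHn]; first by rewrite GRing.addr0 /= mulg1.
  by rewrite -addn1 PoszD GRing.addrA !zexpgS IHn mulgA.
apply: (mulIg x); rewrite -mulgA -!zexpgS.
have -> : (- n.+1%:Z + 1 = - n%:Z)%R by rewrite -addn1 PoszD GRing.opprD GRing.subrK.
by rewrite -IHn -GRing.addrA; congr (zexpg x (m + _)%R);
   rewrite -addn1 PoszD GRing.opprD GRing.subrK.
Qed.

Lemma zexpgN (n : int) : zexpg x (- n)%R = (zexpg x n)^-1.
Proof. by apply: (mulgI (zexpg x n)); rewrite -zexpgD GRing.subrr mulgV. Qed.

Lemma zexpgB (m n : int) : zexpg x (m - n)%R = zexpg x m / zexpg x n.
Proof. by rewrite zexpgD zexpgN. Qed.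

End IntegerPowers.

Definition derived_set (G : groupType) : set G :=
  smallest [set S : set G | group_closed (mem S)]
           [set z | exists x y : G, z = [~ x, y]].

Arguments derived_set : clear implicits.

Lemma derived_set_closed (G : groupType) : group_closed (mem (derived_set G)).
Proof.
split; first by rewrite inE => S [[+ _] _]; rewrite in_setE.
move=> x y; rewrite !inE => dx dy S [[S1 SB] sS].
have := SB x y; rewrite !in_setE; apply; first exact: dx.
exact: dy.
Qed.

Record derived_group (G : groupType) := DerivedGroup {
  derived_val :> G;
  _ : derived_val \in derived_set G }.

HB.instance Definition _ (G : groupType) := [isSub for @derived_val G].
HB.instance Definition _ (G : groupType) := [Choice of derived_group G by <:].
HB.instance Definition _ (G : groupType) :=
  SubChoice_isSubGroup.Build G _ (derived_group G) (derived_set_closed G).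

Definition nontrivial_hom (G H : groupType) (rho : G -> H) : Prop :=
  exists g, rho g != 1.

Definition homeomorphism (X Y : topologicalType) (f : X -> Y) : Prop :=
  continuous f /\
  exists g : Y -> X, [/\ continuous g, cancel f g & cancel g f].

Record homeo (X : topologicalType) := Homeo {
  homeo_fun :> X -> X;
  _ : `[< homeomorphism homeo_fun >] }.

HB.instance Definition _ (X : topologicalType) := [isSub for @homeo_fun X].
HB.instance Definition _ (X : topologicalType) := [Choice of homeo X by <:].

Section HomeoGroup.
Variable X : topologicalType.
Implicit Types f g h : homeo X.

Lemma homeoP f : homeomorphism f.
Proof. exact/asboolP/(valP f). Qed.

Lemma homeo_eqP f g : f =1 g -> f = g.
Proof. by move=> fg; apply: val_inj; apply/funext. Qed.

Lemma homeo1_subproof : `[< homeomorphism (@idfun X) >].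
Proof.
apply/asboolP; split; first by move=> x; exact: cvg_id.
by exists idfun; split=> // x; exact: cvg_id.
Qed.

Definition homeo1 : homeo X := Homeo homeo1_subproof.

Lemma homeoM_subproof f g : `[< homeomorphism (f \o g) >].
Proof.
apply/asboolP.
have [cf [f' [cf' fK f'K]]] := homeoP f.
have [cg [g' [cg' gK g'K]]] := homeoP g.
split; first by move=> x; apply: continuous_comp; [exact: cg|exact: cf].
exists (g' \o f'); split.
- by move=> x; apply: continuous_comp; [exact: cf'|exact: cg'].
- exact: can_comp.
- exact: can_comp.
Qed.

Definition homeoM f g : homeo X := Homeo (homeoM_subproof f g).

Definition homeo_inv f : X -> X := projT1 (cid (homeoP f).2).

Lemma homeo_invP f :
  [/\ continuous (homeo_inv f), cancel f (homeo_inv f) & cancel (homeo_inv f) f].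
Proof. exact: projT2 (cid (homeoP f).2). Qed.

Lemma homeoV_subproof f : `[< homeomorphism (homeo_inv f) >].
Proof.
have [cg fK gK] := homeo_invP f; apply/asboolP; split=> //.
by exists f; split=> //; exact: (homeoP f).1.
Qed.

Definition homeoV f : homeo X := Homeo (homeoV_subproof f).

Lemma homeoVK f : cancel (homeoV f) f.
Proof. by case: (homeo_invP f). Qed.

Lemma homeoKV f : cancel f (homeoV f).
Proof. by case: (homeo_invP f). Qed.

Lemma homeoA : associative homeoM.
Proof. by move=> f g h; apply: homeo_eqP. Qed.

Lemma homeo1M : left_id homeo1 homeoM.
Proof. by move=> f; apply: homeo_eqP. Qed.

Lemma homeoM1 : right_id homeo1 homeoM.
Proof. by move=> f; apply: homeo_eqP. Qed.

Lemma homeoVM : left_inverse homeo1 homeoV homeoM.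
Proof. by move=> f; apply: homeo_eqP => x; exact: homeoKV. Qed.

Lemma homeoMV : right_inverse homeo1 homeoV homeoM.
Proof. by move=> f; apply: homeo_eqP => x; exact: homeoVK. Qed.

HB.instance Definition _ :=
  isGroup.Build (homeo X) homeoA homeo1M homeoM1 homeoVM homeoMV.

End HomeoGroup.

Definition is_full (X : topologicalType) (u : homeo X) : set (homeo X) :=
  [set g | forall x : X, exists n : int, \forall y \near x, g y = zexpg u n y].

Lemma is_full_closed (X : topologicalType) (u : homeo X) :
  group_closed (mem (is_full u)).
Proof.
split; first by rewrite inE => x; exists 0%R; near=> y.
move=> g h; rewrite !inE => Fg Fh x.
pose h' := homeoV h.
have [n gn] := Fg (h' x); have [m hm] := Fh (h' x).
have ch : h' @ x --> h' x by exact: (homeoP h').1.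
exists (n - m)%R; near=> y.
have gy : g (h' y) = zexpg u n (h' y) by near: y; exact: ch gn.
have hy : h (h' y) = zexpg u m (h' y) by near: y; exact: ch hm.
rewrite zexpgB -[LHS]/(g (h' y)) gy.
rewrite -[RHS]/(zexpg u n (homeoV (zexpg u m) y)).
congr (zexpg u n _).
by rewrite -[in RHS](homeoVK h y) hy homeoKV.
Unshelve. all: by end_near.
Qed.

Record full_group (X : topologicalType) (u : homeo X) := FullGroup {
  full_val :> homeo X;
  _ : full_val \in is_full u }.

HB.instance Definition _ X u := [isSub for @full_val X u].
HB.instance Definition _ X u := [Choice of @full_group X u by <:].
HB.instance Definition _ X u :=
  SubChoice_isSubGroup.Build (homeo X) _ (@full_group X u) (is_full_closed u).

Definition cantor_minimal (X : topologicalType) (u : homeo X) : Prop :=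
  (exists h : X -> cantor_space, homeomorphism h) /\
  forall x : X, dense (range (fun n : int => zexpg u n x)).

Definition is_orbit_cocycle (X : topologicalType) (u g : homeo X)
    (k : X -> int) : Prop :=
  continuous (k : X -> discrete_topology int) /\
  forall x, g x = zexpg u (k x) x.

(* For a Cantor minimal system this is the unique k with is_orbit_cocycle u g k,
   by orbit_cocycleP and orbit_cocycle_unique. *)
Definition orbit_cocycle (X : topologicalType) (u g : homeo X) : X -> int :=
  xget (fun=> 0%R) [set k | is_orbit_cocycle u g k].

Lemma zexpg_fix (X : topologicalType) (u : homeo X) (m : nat) (n : int) (x : X) :
  zexpg u m.+1 x = x -> exists2 i : nat, (i < m.+1)%N & zexpg u n x = zexpg u i x.
Proof.
move=> ux.
have Nux : zexpg u (- m.+1%:Z)%R x = x.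
  by rewrite -[in LHS]ux zexpgN -[LHS]/(homeoV (zexpg u m.+1) _) homeoKV.
have addux (i j : int) : zexpg u (i + j)%R x = zexpg u i (zexpg u j x).
  by rewrite zexpgD.
have mulux (a : int) : zexpg u (a * m.+1%:Z)%R x = x.
  elim/int_rect: a => [|a IHa|a IHa]; first by rewrite GRing.mul0r.
    by rewrite -addn1 PoszD GRing.mulrDl GRing.mul1r addux ux.
  by rewrite -addn1 PoszD GRing.opprD GRing.mulrDl GRing.mulN1r addux Nux.
have : (0 <= n %% m.+1%:Z)%Z%R by exact: modz_ge0.
have : (n %% m.+1%:Z < m.+1%:Z)%Z%R by exact: ltz_pmod.
rewrite {3}(divz_eq n m.+1%:Z) GRing.addrC addux mulux.
by case: (n %% m.+1%:Z)%Z => // i lti _; exists i.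
Qed.

Lemma cantor_minimal_free (X : topologicalType) (u : homeo X) (n : int) (x : X) :
  cantor_minimal u -> zexpg u n x = x -> n = 0%R.
Proof.
move=> [[h [ch [h' [ch' hK h'K]]]] dx] ux.
apply: contrapT => n0.
have [m um] : exists m : nat, zexpg u m.+1 x = x.
  case: n n0 ux => [[//|m] _|m _ ux]; first by exists m.
  exists m; rewrite -[RHS](homeoVK (zexpg u m.+1)).
  by rewrite -[X in _ = zexpg u m.+1 X]/(zexpg u (Negz m) x) ux.
pose A := [set zexpg u i x | i in `I_m.+1].
have finA : finite_set (h @` A) by apply/finite_image/finite_image/finite_II.
have clA : closed (h @` A).
  exact: (accessible_finite_set_closed.1
            (hausdorff_accessible cantor_space_hausdorff)) finA.
have [z Az] : (~` (h @` A)) !=set0.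
  apply: contrapT => /set0P/negP/negPn/eqP A0.
  pose e (i : nat) : cantor_space := fun j : nat => i == j.
  apply: infinite_nat; rewrite -(_ : e @^-1` (h @` A) = setT).
    apply: finite_preimage finA => i j _ _ /(congr1 (fun c => c j)).
    by rewrite /e eqxx => /eqP.
  apply/seteqP; split=> // i _; apply: contrapT => eA.
  by have : set0 (e i) by rewrite -A0.
have [] := dx x (h @^-1` ~` (h @` A)).
- by exists (h' z) => /=; rewrite h'K.
- by apply: open_comp => [y _|]; [exact: ch|exact: closed_openC].
move=> y [/= nAy [i _ iy]]; apply: nAy; exists y => //.
by have [j ltj ij] := zexpg_fix i um; exists j; rewrite //= -ij iy.
Qed.

Lemma orbit_cocycle_unique (X : topologicalType) (u g : homeo X) (k k' : X -> int) :
  cantor_minimal u -> is_orbit_cocycle u g k -> is_orbit_cocycle u g k' -> k = k'.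
Proof.
move=> mu [_ gk] [_ gk']; apply/funext => x.
apply/eqP; rewrite -GRing.subr_eq0; apply/eqP.
apply: (cantor_minimal_free (x := x) mu).
rewrite GRing.addrC zexpgD zexpgN -[LHS]/(homeoV (zexpg u (k' x)) (zexpg u (k x) x)).
by rewrite -gk gk' homeoKV.
Qed.

Lemma orbit_cocycleP (X : topologicalType) (u g : homeo X) :
  cantor_minimal u -> is_full u g -> is_orbit_cocycle u g (orbit_cocycle u g).
Proof.
move=> mu Fg; apply: (@xgetPex _ _ [set k | is_orbit_cocycle u g k]).
pose k x := projT1 (cid (Fg x)).
have kP x : \forall y \near x, g y = zexpg u (k x) y := projT2 (cid (Fg x)).
have gk x : g x = zexpg u (k x) x by exact: nbhs_singleton (kP x).
exists k; split=> // x A /= /nbhs_singleton Akx.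
suff kx : \forall y \near x, k x = k y.
  by apply: (filterS _ kx) => y /= <-.
near=> y.
apply/eqP; rewrite -GRing.subr_eq0; apply/eqP.
apply: (cantor_minimal_free (x := y) mu).
rewrite GRing.addrC zexpgD zexpgN -[LHS]/(homeoV (zexpg u (k y)) (zexpg u (k x) y)).
rewrite (_ : zexpg u (k x) y = zexpg u (k y) y) ?homeoKV// -gk; apply/esym.
by near: y; exact: kP.
Unshelve. all: by end_near.
Qed.

Definition supp (X : topologicalType) (v : homeo X) : set X :=
  closure [set x | v x != x].

Lemma supp_stable (X : topologicalType) (v : homeo X) (x : X) :
  x \in supp v -> v x \in supp v.
Proof.
rewrite !inE => sx B nB.
have [y [vy By]] := sx _ ((homeoP v).1 x _ nB).
exists (v y); split=> //=; apply: contra_neq vy => vvy.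
exact: can_inj (homeoKV v) _ _ vvy.
Qed.

Definition supp_map (X : topologicalType) (v : homeo X) (y : supp v) : supp v :=
  exist _ (v (val y)) (supp_stable (valP y)).

Definition factor_map (Y X : topologicalType) (v : Y -> Y) (u : X -> X)
    (q : Y -> X) : Prop :=
  [/\ continuous q, range q = [set: X] & u \o q = q \o v].

Definition factors_onto (Y X : topologicalType) (v : Y -> Y) (u : X -> X) : Prop :=
  exists q : Y -> X, factor_map v u q.

Definition induced_by (X1 X2 : topologicalType) (u1 : homeo X1) (u2 : homeo X2)
    (v : full_group u2) (q : supp v -> X1)
    (rho : derived_group (full_group u1) -> full_group u2) : Prop :=
  forall g : derived_group (full_group u1),
    (forall y : supp v,
       rho g (val y) = zexpg v (orbit_cocycle u1 (full_val (derived_val g)) (q y)) (val y)) /\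
    (forall x : X2, ~ supp v x -> rho g x = x).

(* Main.v *)
Require Import Defs.
From HB Require Import structures.
From mathcomp Require Import all_boot all_order all_algebra.
From mathcomp Require Import boolp classical_sets functions topology cantor.
From mathcomp Require Import zify.

(** Why the theorem is true.

Write F1, F2 for the two full groups and D for the derived group of F1.  For a
clopen set U of X1, alt U is the group generated by the 3-cycles living in U: a
3-cycle permutes cyclically three disjoint clopen sets a(A), b(A), c(A) inside
U, with a, b, c in F1.  Three facts about these groups carry the proof.
- D = alt setT (derived_setE).  F1 is generated by u1 and the swaps of two
  disjoint clopen sets (full_generated), and every commutator with a swap is a
  product of 3-cycles (swap_commutator); so F1 is abelian modulo alt setT.
- alt U is simple (alt_simple) and, when U is not empty, contains elements of
  infinite order (alt_infinite_order).
- alt U and alt V generate alt (U `|` V) when U and V meet (alt_union).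

Let R be a nontrivial homomorphism from D to F2, and y a point of X2.  An orbit
of F2 is a copy of the integers on which every element has bounded
displacement.  On the line there is room only for boundedly many disjoint
infinite orbits of one map t, whence a commuting group, which permutes these
orbits, must do so through a finite group and a group of translations; being
simple, the group alt U fixes every point whose orbit under an element t that
commutes with alt U is infinite (commuting_fixes).  If alt V moves y, an element t
of infinite order of alt V has an infinite orbit in the closure of the orbit of y
under alt V: the length of finite orbits is locally constant, so otherwise a power
of t would act trivially there.  Passing to this limit point gives the key
alternative: for each clopen V, either alt V or alt (~` V) fixes y
(fixes_clopen_or_complement).

It follows that the clopen sets U such that alt U fixes y are stable under
unions (fixes_union).  By compactness, if D moves y, there is exactly one point
x of X1 all of whose clopen neighbourhoods V have alt V moving y; this point is
q(y), and alt V fixes y exactly when x is not in V.  The map q is equivariant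
and the stabilizers of y and q(y) in D coincide (stabilizer): all the 3-cycles
that send x to a given other point send y to the same point
(cyc3_determined), because two of them differ by an element that lives away from
x.  Therefore v(y) := R(c)(y), for any c in D with c(x) = u1(x), is well
defined; it is locally given by elements of F2, q intertwines it with u1, and
R(g)(y) = v^n(y) when g(x) = u1^n(x).

Conversely a pair (v, q) makes the orbits of v over the support free, and
inserting the cocycle of g at q(y) as an exponent of v defines a homomorphism
on the whole of F1, injective since q is onto.  The pair is determined by the
homomorphism: the support is the set of moved points, q(y) is the only point
with the stabilizer of y, and v is read off elements of D that coincide with
u1 at q(y). *)

Set Implicit Arguments.
Unset Strict Implicit.
Unset Printing Implicit Defensive.

Local Open Scope classical_set_scope.
Local Open Scope group_scope.

(** * Compactness and Cantor minimal systems *)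

(** The form in which compactness is used throughout: a property of sets that
survives unions and holds locally holds for some set containing the given compact
set. *)
Lemma compact_ideal (Y : topologicalType) (K : set Y) (J : set Y -> Prop) :
  compact K -> J set0 -> (forall A B, J A -> J B -> J (A `|` B)) ->
  (forall x, K x -> exists A, [/\ open A, A x & J A]) ->
  exists2 A, K `<=` A & J A.
Proof.
move=> cK J0 JU Jx; apply: contrapT => nK.
pose G := filter_from J (fun A => K `\` A).
have PG : ProperFilter G.
  apply: filter_from_proper; last first.
    move=> A JA; apply: contrapT => KA; apply: nK; exists A => // x Kx.
    by apply: contrapT => Ax; apply: KA; exists x.
  apply: filter_from_filter; first by exists set0.
  move=> A B JA JB; exists (A `|` B); first exact: JU.
  by move=> x [Kx nAB]; split; split=> // ?; apply: nAB; [left|right].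
have [|x [Kx clx]] := cK G PG; first by exists set0 => // x [].
have [A [oA Ax JA]] := Jx x Kx.
have [||y [[_ nAy] Ay]] := clx (K `\` A) A; last by [].
  by exists A.
exact: open_nbhs_nbhs.
Qed.

Section CantorMinimal.
Variables (X : topologicalType) (u : homeo X) (mu : cantor_minimal u).
Notation F := (full_group u).
Implicit Types (f g h k : F) (x y : X) (A B U V : set X) (n : int).

Lemma cantor_minimal_compact : compact [set: X].
Proof.
have [[h [_ [h' [ch' hK h'K]]]] _] := mu.
have -> : [set: X] = h' @` [set: cantor_space].
  by apply/seteqP; split=> // x _; exists (h x).
apply: continuous_compact; last exact: cantor_space_compact.
exact: continuous_subspaceT.
Qed.

Lemma cantor_minimal_zero_dimensional : zero_dimensional X.
Proof.
have [[h [ch [h' [_ hK h'K]]]] _] := mu.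
move=> x y xy.
have [|W [[oW cW] Wx nWy]] := @cantor_zero_dimensional (h x) (h y).
  by rewrite (can_eq hK).
exists (h @^-1` W); split=> //; split.
  by apply: open_comp => // z _; exact: ch.
by apply: closed_comp => // z _; exact: ch.
Qed.

Lemma cantor_minimal_hausdorff : hausdorff_space X.
Proof.
have [[h [ch [h' [_ hK h'K]]]] _] := mu.
move=> x y clxy; apply: (can_inj hK); apply: cantor_space_hausdorff => A B hA hB.
have [z [Az Bz]] := clxy _ _ (ch _ _ hA) (ch _ _ hB).
by exists (h z).
Qed.

Lemma clopen_basis x (O : set X) : nbhs x O -> exists A, [/\ clopen A, A x & A `<=` O].
Proof.
move=> /(@zero_dimensional_cvg _ x cantor_minimal_hausdorff
  cantor_minimal_zero_dimensional cantor_minimal_compact).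
by move=> [A [Ax cA] AO]; exists A.
Qed.

Lemma not_isolated x : ~ open [set x].
Proof.
have [[h [ch [h' [ch' hK h'K]]]] _] := mu.
move=> ox; have /perfectTP := cantor_perfect => /(_ (h x)); apply.
have -> : [set h x] = h' @^-1` [set x].
  apply/seteqP; split=> z /=; first by move=> ->.
  by move=> <-; rewrite h'K.
by apply: open_comp => // z _; exact: ch'.
Qed.

(** No point is isolated, so removing finitely many points from a nonempty open
set leaves a nonempty open set. *)
Lemma open_avoid U (s : seq X) : open U -> U !=set0 ->
  exists V, [/\ open V, V !=set0, V `<=` U & forall x, V x -> x \notin s].
Proof.
move=> oU U0; elim: s => [|p s [V [oV [x Vx] VU Vs]]]; first by exists U; split.
have op : open (V `&` ~` [set p]).
  apply: openI => //; apply: closed_openC.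
  exact: (accessible_closed_set1 (hausdorff_accessible cantor_minimal_hausdorff)).
exists (V `&` ~` [set p]); split=> //; first last.
- by move=> z [Vz /= zp]; rewrite inE negb_or Vs// andbT; exact/eqP.
- by move=> z [/VU].
apply: contrapT => V0; apply: (@not_isolated x).
suff -> : [set x] = V by [].
have Vp z : V z -> z = p by move=> Vz; apply: contrapT => zp; apply: V0; exists z.
by apply/seteqP; split=> [z -> //|z /Vp ->]; rewrite (Vp x).
Qed.

Lemma fullM g h x : (g * h) x = g (h x). Proof. by []. Qed.

Lemma fullKV g x : g^-1 (g x) = x.
Proof. by rewrite -fullM mulVg. Qed.
Lemma fullVK g x : g (g^-1 x) = x.
Proof. by rewrite -fullM mulgV. Qed.
Lemma full_inj g : injective g.
Proof. exact: can_inj (fullKV g). Qed.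
Lemma full_ext g h : g =1 h -> g = h.
Proof. by move=> gh; apply: val_inj; exact: homeo_eqP. Qed.
Lemma full_continuous g : continuous g. Proof. exact: (homeoP g).1. Qed.


Lemma is_full_self : u \in is_full u.
Proof. by rewrite inE => x; exists 1%R; near=> y. Unshelve. all: by end_near. Qed.
Definition gen : F := FullGroup is_full_self.

Lemma zexpgE n x : zexpg gen n x = zexpg u n x.
Proof.
have E (m : nat) y : (gen ^+ m : F) y = (u ^+ m : homeo X) y.
  elim: m y => [|m IH] y; first by [].
  by rewrite !expgSr -[RHS]/((u ^+ m) (u y)) fullM IH.
case: n => n /=; first exact: E.
apply: (@full_inj (gen ^+ n.+1)); rewrite fullVK E.
by rewrite -[RHS]/((u ^+ n.+1 * u ^- n.+1 : homeo X) x) mulgV.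
Qed.

Lemma full_local g x : exists n, \forall y \near x, g y = zexpg gen n y.
Proof.
have : is_full u g by have /set_mem := valP g.
move=> /(_ x) [n Hn]; exists n; apply: filterS Hn => y ->.
by rewrite zexpgE.
Qed.

Lemma gen_free n x : zexpg gen n x = x -> n = 0%R.
Proof. by rewrite zexpgE; exact: cantor_minimal_free. Qed.

Lemma zexpgDE f (m n : int) x : zexpg f (m + n)%R x = zexpg f m (zexpg f n x).
Proof. by rewrite zexpgD. Qed.

Lemma zexpg_gen_inj x : injective (fun n => zexpg gen n x).
Proof.
move=> m n /= /(congr1 (zexpg gen (- n)%R)); rewrite -!zexpgDE GRing.addNr => /gen_free.
by move=> /eqP; rewrite GRing.addrC GRing.subr_eq0 => /eqP.
Qed.

(** Both elements are powers of u near each point, and powers of u act freely: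
elements that agree at a point agree around it. *)
Lemma full_eq_clopen g h : clopen [set x | g x = h x].
Proof.
split.
  rewrite openE => x /= gh; rewrite /interior.
  have [n gn] := full_local g x; have [m hm] := full_local h x.
  have nm : n = m.
    apply: (@zexpg_gen_inj x) => /=.
    by rewrite -(nbhs_singleton gn) -(nbhs_singleton hm).
  by near=> y => /=; rewrite (near gn y)// (near hm y)// nm.
rewrite -[X in closed X]setCK; apply: open_closedC.
rewrite openE => x /= gh; rewrite /interior.
have [n gn] := full_local g x; have [m hm] := full_local h x.
near=> y => /=; rewrite (near gn y)// (near hm y)//.
move=> /zexpg_gen_inj nm; apply: gh.
by rewrite (nbhs_singleton gn) (nbhs_singleton hm) nm.
Unshelve. all: by end_near. Qed.

(** Continuity need not be assumed: it follows, for f and for its inverse, from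
the local description. *)
Lemma full_build (f f' : X -> X) : cancel f f' -> cancel f' f ->
  (forall x, exists n, \forall y \near x, f y = zexpg gen n y) ->
  exists g : F, g =1 f.
Proof.
move=> fK f'K fl.
have cf : continuous f.
  move=> x; have [n fn] := fl x => A; rewrite (nbhs_singleton fn) => nA.
  have nA' : nbhs x (zexpg gen n @^-1` A) := @full_continuous (zexpg gen n) x _ nA.
  by change (nbhs x (f @^-1` A)); apply: filterS (filterI nA' fn) => y /= [? ->].
have cf' : continuous f'.
  move=> y; have [n fn] := fl (f' y) => A nA.
  have yE : y = zexpg gen n (f' y) by rewrite -(nbhs_singleton fn) f'K.
  have N1 : nbhs (f' y) (A `&` [set z | f z = zexpg gen n z]) by exact: filterI.
  have yE' : f' y = zexpg gen (- n)%R y by rewrite {2}yE -zexpgDE GRing.addNr.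
  rewrite yE' in N1.
  have N2 : nbhs y (zexpg gen (- n)%R @^-1` _) := @full_continuous (zexpg gen (- n)%R) y _ N1.
  change (nbhs y (f' @^-1` A)); apply: filterS N2 => z /= [Az].
  rewrite -zexpgDE GRing.subrr => fz.
  have {}fz : f (zexpg gen (- n)%R z) = z := fz.
  by rewrite -[z in f' z]fz fK.
have Hf : `[< homeomorphism f >] by apply/asboolP; split=> //; exists f'.
have fF : Homeo Hf \in is_full u.
  rewrite inE => x; have [n fn] := fl x; exists n.
  by apply: filterS fn => y /= ->; rewrite zexpgE.
by exists (FullGroup fF).
Qed.

Lemma clopen_preimage g A : clopen A -> clopen (g @^-1` A).
Proof.
move=> [oA cA]; split.
  by apply: open_comp => // x _; exact: full_continuous.
by apply: closed_comp => // x _; exact: full_continuous.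
Qed.

Lemma orbit_dense x (U : set X) : open U -> U !=set0 -> exists n, U (zexpg gen n x).
Proof.
move=> oU U0; have [_ /(_ x U U0 oU)] := mu.
by move=> [z [Uz [n _ nz]]]; exists n; rewrite zexpgE nz.
Qed.

Lemma displacement_bounded g :
  exists c : nat, forall x, exists2 n : int, (`|n|%N <= c)%N & g x = zexpg gen n x.
Proof.
pose J A := exists c : nat, forall x, A x ->
  exists2 n : int, (`|n|%N <= c)%N & g x = zexpg gen n x.
have [||A B [c Hc] [d Hd]|x _|A TA [c Hc]] := @compact_ideal X setT J.
- exact: cantor_minimal_compact.
- by exists 0%N.
- exists (maxn c d) => x [/Hc|/Hd] [n nc gn]; exists n => //; lia.
- have [n] := full_local g x; rewrite /prop_near1 nbhsE => -[A [oA Ax] AE].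
  by exists A; split=> //; exists `|n|%N => y /AE; exists n.
- by exists c => x; apply: Hc; exact: TA.
Qed.

End CantorMinimal.

(** * Swaps of two disjoint clopen sets *)
Section Swaps.
Variables (X : topologicalType) (u : homeo X).
Notation F := (full_group u).
Implicit Types (a b c d e f g h k : F) (x y z : X) (A B U V : set X).

Lemma full_paste (f f' : X -> X) : cancel f f' -> cancel f' f ->
  (forall x, exists (k : F) A, [/\ open A, A x & forall y, A y -> f y = k y]) ->
  exists g : F, g =1 f.
Proof.
move=> fK f'K fl; apply: (full_build fK f'K) => x.
have [k [A [oA Ax fk]]] := fl x; have [n kn] := full_local k x.
exists n; apply: filterS2 kn (open_nbhs_nbhs (conj oA Ax)) => y ky /fk ->.
exact: ky.
Qed.

Definition apart A g h := forall x y, A x -> A y -> g x <> h y.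

Lemma apart_sym A g h : apart A g h -> apart A h g.
Proof. by move=> gh x y Ax Ay /esym; exact: gh. Qed.

Lemma apart_sub A B g h : B `<=` A -> apart A g h -> apart B g h.
Proof. by move=> BA gh x y /BA Ax /BA; exact: gh. Qed.

Definition swap_fun A g h y : X :=
  if `[< A (g^-1 y) >] then h (g^-1 y)
  else if `[< A (h^-1 y) >] then g (h^-1 y) else y.

(** The default value 1 only serves when the two images overlap. *)
Definition swap A g h : F := xget 1 [set f : F | f =1 swap_fun A g h].

Definition is_swap A g h f :=
  [/\ forall x, A x -> f (g x) = h x, forall x, A x -> f (h x) = g x &
      forall y, (forall x, A x -> y <> g x /\ y <> h x) -> f y = y].

Lemma is_swap_fun A g h (f : X -> X) : apart A g h -> f =1 swap_fun A g h ->
  [/\ forall x, A x -> f (g x) = h x, forall x, A x -> f (h x) = g x &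
      forall y, (forall x, A x -> y <> g x /\ y <> h x) -> f y = y].
Proof.
move=> gh fE; split=> [x Ax|x Ax|y Hy]; rewrite fE /swap_fun.
- by rewrite !fullKV ifT//; exact/asboolP.
- rewrite ifF; first by rewrite fullKV ifT//; exact/asboolP.
  by apply/asboolP => /gh /(_ Ax); rewrite fullVK.
- rewrite ifF; last first.
    by apply/asboolP => /Hy []; rewrite fullVK.
  by rewrite ifF//; apply/asboolP => /Hy []; rewrite fullVK.
Qed.

Lemma level_cases A g y : (exists2 x, A x & y = g x) \/ (forall x, A x -> y <> g x).
Proof.
have [[x Ax yx]|H] := pselect (exists2 x, A x & y = g x); first by left; exists x.
by right=> x Ax yx; apply: H; exists x.
Qed.

Lemma clopen_level A g : clopen A -> clopen [set y | A (g^-1 y)].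
Proof. exact: (@clopen_preimage _ _ g^-1). Qed.

Lemma swapP A g h : clopen A -> apart A g h -> is_swap A g h (swap A g h).
Proof.
move=> cA gh; apply: is_swap_fun => //.
suff : exists f : F, f =1 swap_fun A g h.
  by move=> H; exact: (@xgetPex _ 1 [set f : F | f =1 swap_fun A g h]).
have [sg sh so] := is_swap_fun gh (fun=> erefl).
have sK : cancel (swap_fun A g h) (swap_fun A g h).
  move=> y; have [[x Ax ->]|Hg] := level_cases A g y; first by rewrite sg// sh.
  have [[x Ax ->]|Hh] := level_cases A h y; first by rewrite sh// sg.
  by rewrite !so// => x Ax; split; by [exact: Hg|exact: Hh].
apply: (full_paste sK sK) => y.
have [Ag|nAg] := pselect (A (g^-1 y)).
  exists (h * g^-1), [set z | A (g^-1 z)]; split=> //.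
    by have [] := clopen_level g cA.
  by move=> z Az; rewrite /swap_fun ifT//; exact/asboolP.
have ong : open (~` [set z | A (g^-1 z)]).
  by apply: closed_openC; have [] := clopen_level g cA.
have [Ah|nAh] := pselect (A (h^-1 y)).
  exists (g * h^-1), (~` [set z | A (g^-1 z)] `&` [set z | A (h^-1 z)]); split=> //.
    by apply: openI => //; have [] := clopen_level h cA.
  move=> z [/= nAz Az]; rewrite /swap_fun ifF; last exact/asboolP.
  by rewrite ifT//; exact/asboolP.
exists 1, (~` [set z | A (g^-1 z)] `&` ~` [set z | A (h^-1 z)]); split=> //.
  by apply: openI => //; apply: closed_openC; have [] := clopen_level h cA.
by move=> z [/= nAz nAz']; rewrite /swap_fun ifF ?ifF//; exact/asboolP.
Qed.

Lemma is_swap_uniq A g h f f' : is_swap A g h f -> is_swap A g h f' -> f = f'.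
Proof.
move=> [s1 s2 s3] [t1 t2 t3]; apply: full_ext => y.
have [[x Ax ->]|Hg] := level_cases A g y; first by rewrite s1// t1.
have [[x Ax ->]|Hh] := level_cases A h y; first by rewrite s2// t2.
by rewrite s3 ?t3// => x Ax; split; by [exact: Hg|exact: Hh].
Qed.

Lemma swapC A g h : clopen A -> apart A g h -> swap A g h = swap A h g.
Proof.
move=> cA gh; apply: (is_swap_uniq (swapP cA gh)).
have [s1 s2 s3] := swapP cA (apart_sym gh).
by split=> // y Hy; apply: s3 => x /Hy [].
Qed.

Lemma swapK A g h : clopen A -> apart A g h -> swap A g h * swap A g h = 1.
Proof.
move=> cA gh; have [s1 s2 s3] := swapP cA gh; apply: full_ext => y; rewrite fullM.
have [[x Ax ->]|Hg] := level_cases A g y; first by rewrite s1// s2.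
have [[x Ax ->]|Hh] := level_cases A h y; first by rewrite s2// s1.
by rewrite !s3// => x Ax; split; by [exact: Hg|exact: Hh].
Qed.

(** A swap is labelled by the two maps g and h and not by the sets g(A) and h(A)
because conjugation is then a mere translation of labels; this replaces every
computation in a symmetric group below. *)
Lemma swapJ k A g h : clopen A -> apart A g h ->
  k * swap A g h * k^-1 = swap A (k * g) (k * h).
Proof.
move=> cA gh; have [s1 s2 s3] := swapP cA gh.
have khg : apart A (k * g) (k * h) by move=> x y Ax Ay; rewrite !fullM => /full_inj; exact: gh.
apply: is_swap_uniq (swapP cA khg); split=> [x Ax|x Ax|y Hy]; rewrite !fullM.
- by rewrite fullKV s1.
- by rewrite fullKV s2.
- rewrite s3 ?fullVK// => x /Hy [].
  by rewrite !fullM => H1 H2; split=> E; [apply: H1|apply: H2]; rewrite -E fullVK.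
Qed.

Lemma swap_local A g h g' h' : clopen A -> apart A g h ->
  (forall x, A x -> g x = g' x) -> (forall x, A x -> h x = h' x) ->
  swap A g h = swap A g' h'.
Proof.
move=> cA gh gg hh; have gh' : apart A g' h'.
  by move=> x y Ax Ay; rewrite -gg// -hh//; exact: gh.
apply: (is_swap_uniq (swapP cA gh)); have [s1 s2 s3] := swapP cA gh'.
split=> [x Ax|x Ax|y Hy]; rewrite ?gg// ?hh// ?s1// ?s2//.
by apply: s3 => x Ax; rewrite -gg// -hh//; exact: Hy.
Qed.

Lemma swapU A B g h : clopen A -> clopen B -> A `&` B = set0 ->
  apart (A `|` B) g h -> swap (A `|` B) g h = swap A g h * swap B g h.
Proof.
move=> cA cB AB0 gh.
have ghA : apart A g h by apply: apart_sub gh => ?; left.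
have ghB : apart B g h by apply: apart_sub gh => ?; right.
have [s1 s2 s3] := swapP cA ghA; have [t1 t2 t3] := swapP cB ghB.
apply: (is_swap_uniq (swapP (clopenU cA cB) gh)).
have nAB x y : A x -> B y -> x <> y.
  move=> Ax By xy; have : (A `&` B) x by split=> //; rewrite xy.
  by rewrite AB0.
have gh' x y : (A `|` B) x -> (A `|` B) y -> g x <> h y by exact: gh.
split=> [x [Ax|Bx]|x [Ax|Bx]|y Hy]; rewrite fullM.
- rewrite t3 ?s1// => z Bz; split; last by apply: gh; [left|right].
  by move=> /full_inj; exact: nAB.
- rewrite t1// s3// => z Az; split; last by move=> /full_inj /esym; exact: nAB.
  by move=> /esym; apply: gh; [left|right].
- rewrite t3 ?s2// => z Bz; split; last by move=> /full_inj; exact: nAB.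
  by move=> /esym; apply: gh; [right|left].
- rewrite t2// s3// => z Az; split; first by move=> /full_inj /esym; exact: nAB.
  by apply: gh; [right|left].
- by rewrite t3 ?s3// => x ?; apply: Hy; [left|right].
Qed.

Lemma swap_reparam k A g h : clopen A -> apart A g h ->
  swap A g h = swap [set x | A (k x)] (g * k) (h * k).
Proof.
move=> cA gh; have cA' := clopen_preimage k cA.
have gh' : apart [set x | A (k x)] (g * k) (h * k) by move=> x y Ax Ay; exact: gh.
apply: is_swap_uniq (swapP cA' gh'); have [s1 s2 s3] := swapP cA gh.
split=> [x Ax|x Ax|y Hy]; [exact: s1|exact: s2|].
apply: s3 => x Ax; have := Hy (k^-1 x); rewrite !fullM fullVK; apply.
by change (A (k (k^-1 x))); rewrite fullVK.
Qed.

End Swaps.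

(** * 3-cycles and the groups they generate *)
Section Alternating.
Variables (X : topologicalType) (u : homeo X) (mu : cantor_minimal u).
Notation F := (full_group u).
Implicit Types (a b c d e f g h k : F) (x y z : X) (A B U V : set X).

Record tri A a b c : Prop := Tri {
  tri_clopen : clopen A;
  tri12 : apart A a b;
  tri23 : apart A b c;
  tri13 : apart A a c }.

(** As permutations of the labels, (a b)(b c) sends a to b, b to c and c to a. *)
Definition cyc A a b c : F := swap A a b * swap A b c.

Definition is_cyc A a b c f :=
  [/\ forall x, A x -> f (a x) = b x, forall x, A x -> f (b x) = c x,
      forall x, A x -> f (c x) = a x &
      forall y, (forall x, A x -> [/\ y <> a x, y <> b x & y <> c x]) -> f y = y].

Lemma cycP A a b c : tri A a b c -> is_cyc A a b c (cyc A a b c).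
Proof.
move=> [cA ab bc ac].
have [s1 s2 s3] := swapP cA ab; have [t1 t2 t3] := swapP cA bc.
split=> [x Ax|x Ax|x Ax|y Hy]; rewrite /cyc fullM.
- by rewrite t3 ?s1// => z Az; split; [exact: ab|exact: ac].
- rewrite t1// s3// => z Az; split; apply: nesym; [exact: ac|exact: bc].
- by rewrite t2// s2.
- by rewrite t3 ?s3// => x /Hy [].
Qed.

Lemma is_cyc_uniq A a b c f f' :
  is_cyc A a b c f -> is_cyc A a b c f' -> f = f'.
Proof.
move=> [s1 s2 s3 s4] [t1 t2 t3 t4]; apply: full_ext => y.
have [[x Ax ->]|Ha] := level_cases A a y; first by rewrite s1// t1.
have [[x Ax ->]|Hb] := level_cases A b y; first by rewrite s2// t2.
have [[x Ax ->]|Hc] := level_cases A c y; first by rewrite s3// t3.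
by rewrite s4 ?t4// => x Ax; split; by [exact: Ha|exact: Hb|exact: Hc].
Qed.

Lemma tri_rot A a b c : tri A a b c -> tri A b c a.
Proof. by move=> [cA ab bc ac]; split=> //; exact: apart_sym. Qed.

Lemma tri_rev A a b c : tri A a b c -> tri A c b a.
Proof. by move=> [cA ab bc ac]; split=> //; exact: apart_sym. Qed.

Lemma tri_sub A B a b c : clopen B -> B `<=` A -> tri A a b c -> tri B a b c.
Proof. by move=> cB BA [cA ab bc ac]; split=> //; exact: apart_sub BA _. Qed.

Lemma tri_mul k A a b c : tri A a b c -> tri A (k * a) (k * b) (k * c).
Proof.
by move=> [cA ab bc ac]; split=> // x y Ax Ay; rewrite !fullM => /full_inj;
  [exact: ab|exact: bc|exact: ac].
Qed.

Lemma cyc_rot A a b c : tri A a b c -> cyc A a b c = cyc A b c a.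
Proof.
move=> T; apply: (is_cyc_uniq (cycP T)); have [t1 t2 t3 t4] := cycP (tri_rot T).
by split=> // y Hy; apply: t4 => x /Hy [].
Qed.

Lemma cyc_rev A a b c : tri A a b c -> cyc A c b a * cyc A a b c = 1.
Proof.
move=> T; have [s1 s2 s3 s4] := cycP T; have [t1 t2 t3 t4] := cycP (tri_rev T).
apply: full_ext => y; rewrite fullM.
have [[x Ax ->]|Ha] := level_cases A a y; first by rewrite s1// t2.
have [[x Ax ->]|Hb] := level_cases A b y; first by rewrite s2// t1.
have [[x Ax ->]|Hc] := level_cases A c y; first by rewrite s3// t3.
rewrite s4 ?t4// => x Ax; split; by [exact: Ha|exact: Hb|exact: Hc].
Qed.

Lemma cycV A a b c : tri A a b c -> (cyc A a b c)^-1 = cyc A c b a.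
Proof. by move=> /cyc_rev H; apply: (mulIg (cyc A a b c)); rewrite H mulVg. Qed.

Lemma cyc_sqr A a b c : tri A a b c -> cyc A a b c * cyc A a b c = (cyc A a b c)^-1.
Proof.
move=> T; have [s1 s2 s3 s4] := cycP T; apply: (mulgI (cyc A a b c)).
rewrite mulgV; apply: full_ext => y.
change (cyc A a b c (cyc A a b c (cyc A a b c y)) = y).
have [[x Ax ->]|Ha] := level_cases A a y; first by rewrite s1// s2// s3.
have [[x Ax ->]|Hb] := level_cases A b y; first by rewrite s2// s3// s1.
have [[x Ax ->]|Hc] := level_cases A c y; first by rewrite s3// s1// s2.
rewrite !s4// => x Ax; split; by [exact: Ha|exact: Hb|exact: Hc].
Qed.

Lemma cycJ k A a b c : tri A a b c ->
  k * cyc A a b c * k^-1 = cyc A (k * a) (k * b) (k * c).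
Proof.
move=> [cA ab bc ac]; rewrite /cyc -!swapJ//.
by rewrite !mulgA mulgVK.
Qed.

Lemma cyc_local A a b c a' b' c' : tri A a b c ->
  (forall x, A x -> [/\ a x = a' x, b x = b' x & c x = c' x]) ->
  cyc A a b c = cyc A a' b' c'.
Proof.
move=> [cA ab bc ac] E; rewrite /cyc (@swap_local _ _ A a b a' b')//; first last.
- by move=> x /E [].
- by move=> x /E [].
by congr (_ * _); apply: swap_local => // x /E [].
Qed.

Lemma cyc_reparam k A a b c : tri A a b c ->
  cyc A a b c = cyc [set x | A (k x)] (a * k) (b * k) (c * k).
Proof. by move=> [cA ab bc ac]; rewrite /cyc -!swap_reparam. Qed.

Lemma tri_reparam k A a b c : tri A a b c ->
  tri [set x | A (k x)] (a * k) (b * k) (c * k).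
Proof.
move=> [cA ab bc ac]; split; first exact: clopen_preimage.
- by move=> x y Ax Ay; exact: ab.
- by move=> x y Ax Ay; exact: bc.
- by move=> x y Ax Ay; exact: ac.
Qed.

Lemma cycU A B a b c : clopen A -> clopen B -> A `&` B = set0 ->
  tri (A `|` B) a b c -> cyc (A `|` B) a b c = cyc A a b c * cyc B a b c.
Proof.
move=> cA cB AB0 T; have TA : tri A a b c by apply: tri_sub T => // ?; left.
have TB : tri B a b c by apply: tri_sub T => // ?; right.
apply: (is_cyc_uniq (cycP T)).
have [s1 s2 s3 s4] := cycP TA; have [t1 t2 t3 t4] := cycP TB.
have nAB x y : A x -> B y -> x <> y.
  move=> Ax By xy; have : (A `&` B) x by split=> //; rewrite xy.
  by rewrite AB0.
have [_ ab bc ac] := T.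
have outA x : A x ->
    [/\ cyc B a b c (a x) = a x, cyc B a b c (b x) = b x & cyc B a b c (c x) = c x].
  move=> Ax; split; apply: t4 => y By; split;
    try by [move=> /full_inj; exact: nAB|apply: ab; [left|right]|apply: ac; [left|right]
           |apply: bc; [left|right]|apply: nesym; apply: ab; [right|left]
           |apply: nesym; apply: ac; [right|left]|apply: nesym; apply: bc; [right|left]].
have outB x : B x ->
    [/\ cyc A a b c (a x) = a x, cyc A a b c (b x) = b x & cyc A a b c (c x) = c x].
  move=> Bx; split; apply: s4 => y Ay; split;
    try by [move=> /full_inj/esym; exact: nAB|apply: ab; [right|left]|apply: ac; [right|left]
           |apply: bc; [right|left]|apply: nesym; apply: ab; [left|right]
           |apply: nesym; apply: ac; [left|right]|apply: nesym; apply: bc; [left|right]].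
split=> [x [Ax|Bx]|x [Ax|Bx]|x [Ax|Bx]|y Hy]; rewrite fullM.
- by have [-> _ _] := outA x Ax; exact: s1.
- by rewrite t1//; have [_ ->] := outB x Bx.
- by have [_ -> _] := outA x Ax; exact: s2.
- by rewrite t2//; have [_ _ ->] := outB x Bx.
- by have [_ _ ->] := outA x Ax; exact: s3.
- by rewrite t3//; have [-> _ _] := outB x Bx.
- by rewrite t4 ?s4// => x ?; apply: Hy; [left|right].
Qed.

(** Properties of all sufficiently small clopen sets; x need not belong to the
sets, which makes germs stable under the cutting in clopen_local. *)
Definition germ x (P : set X -> Prop) :=
  exists A0, [/\ clopen A0, A0 x & forall A, clopen A -> A `<=` A0 -> P A].

Lemma germ_imp x (P Q : set X -> Prop) :
  (forall A, clopen A -> P A -> Q A) -> germ x P -> germ x Q.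
Proof.
by move=> PQ [A0 [cA Ax H]]; exists A0; split=> // A cA' AA; apply: PQ => //; exact: H.
Qed.

Lemma germ_and x (P Q : set X -> Prop) :
  germ x P -> germ x Q -> germ x (fun A => P A /\ Q A).
Proof.
move=> [A [cA Ax HA]] [B [cB Bx HB]]; exists (A `&` B); split=> //.
  exact: clopenI.
by move=> C cC CAB; split; [apply: HA|apply: HB] => // y /CAB [].
Qed.

Lemma germ_all (T : eqType) (s : seq T) x (P : T -> set X -> Prop) :
  (forall t, t \in s -> germ x (P t)) ->
  germ x (fun A => forall t, t \in s -> P t A).
Proof.
elim: s => [|t s IHs] H; first by exists setT; split=> //; exact: clopenT.
have H1 : germ x (P t) by apply: H; rewrite mem_head.
have {}IHs := IHs (fun r rs => H r (mem_behead (s := t :: s) rs)).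
apply: germ_imp (germ_and H1 IHs) => A _ [P1 P2] r.
by rewrite inE => /predU1P[->//|]; exact: P2.
Qed.

Lemma germ_witness x (P : set X -> Prop) : germ x P -> exists A, [/\ clopen A, A x & P A].
Proof. by move=> [A [cA Ax H]]; exists A; split=> //; exact: H. Qed.

Lemma germ_clopen x U : clopen U -> U x -> germ x (fun A => forall y, A y -> U y).
Proof. by move=> cU Ux; exists U; split. Qed.

Lemma germ_eq x g h : g x = h x -> germ x (fun A => forall y, A y -> g y = h y).
Proof. by move=> gh; apply: (@germ_clopen _ [set y | g y = h y]) => //; exact: full_eq_clopen. Qed.

Lemma germ_apart x g h : g x <> h x -> germ x (fun A => apart A g h).
Proof.
move=> /eqP gh; have [W [cW Wg Wh]] := cantor_minimal_zero_dimensional mu gh.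
exists (g @^-1` W `&` h @^-1` ~` W); split=> //.
  by apply: clopenI; apply: clopen_preimage => //; exact: clopenC.
by move=> A _ AE y z /AE [/= Wy _] /AE [_ /= Wz] yz; apply: Wz; rewrite -yz.
Qed.

Definition frame A (s : seq F) := forall i j,
  (i != j) && (i < size s)%N && (j < size s)%N -> apart A (nth 1 s i) (nth 1 s j).

(** Distinct points are separated by small clopen sets, so an identity between
permutations of finitely many points of one orbit spreads to neighbourhoods. *)
Lemma germ_frame x (s : seq F) : uniq [seq g x | g <- s] -> germ x (fun A => frame A s).
Proof.
move=> us.
have H : germ x (fun A => forall t : nat * nat,
    t \in [seq (i, j) | i <- iota 0 (size s), j <- iota 0 (size s)] ->
    t.1 != t.2 -> apart A (nth 1 s t.1) (nth 1 s t.2)).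
  apply: (@germ_all _ _ _ (fun t A => t.1 != t.2 -> apart A (nth 1 s t.1) (nth 1 s t.2))).
  move=> t /allpairsP [[i j] [/= + + ->]] /=; rewrite !mem_iota /= !add0n => si sj.
  have [<-|ij] := eqVneq i j.
    by exists setT; split=> //; exact: clopenT.
  apply: germ_imp (germ_apart (_ : nth 1 s i x <> nth 1 s j x)) => //.
  rewrite -!(nth_map 1 x (fun g : F => g x))//.
  by move/eqP; rewrite nth_uniq ?size_map// (negbTE ij).
apply: germ_imp H => A _ H i j /andP[/andP[ij si] sj].
apply: (H (i, j)) => //; apply/allpairsP; exists (i, j); split=> //=;
  by rewrite mem_iota.
Qed.

(** A clopen set is a finite disjoint union of arbitrarily small clopen sets. *)
Lemma clopen_local A (J : set X -> Prop) : clopen A -> J set0 ->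
  (forall B C, clopen B -> clopen C -> B `&` C = set0 -> B `|` C `<=` A ->
     J B -> J C -> J (B `|` C)) ->
  (forall x, A x -> germ x J) -> J A.
Proof.
move=> cA J0 JU Jx.
pose J' B := clopen B /\ forall C, clopen C -> C `<=` B -> C `<=` A -> J C.
have [||B1 B2 [c1 J1] [c2 J2]|x Ax|B AB [cB JB]] := @compact_ideal X A J'.
- apply: (subclosed_compact _ (cantor_minimal_compact mu)) => //.
  by have [] := cA.
- by split; [exact: clopen0|move=> C _; rewrite subset0 => ->].
- split; first exact: clopenU.
  move=> C cC CB CA; have -> : C = (C `&` B1) `|` (C `&` ~` B1).
    by rewrite -setIUr setUv setIT.
  have cC1 : clopen (C `&` B1) by exact: clopenI.
  have cC2 : clopen (C `&` ~` B1) by apply: clopenI => //; exact: clopenC.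
  apply: JU => //.
  + by rewrite setIACA setICr setI0.
  + by rewrite -setIUr setUv setIT.
  + by apply: J1 => // y [] // /CA.
  + apply: J2 => // [y [/CB[]//]|y [/CA]//].
- have [B [cB Bx JB]] := Jx x Ax; exists B; split=> //; first by have [] := cB.
  by split=> // C cC CB _; exact: JB.
- exact: JB.
Qed.

(** An orbit visits U infinitely often; this provides the extra points that the
computations with 3-cycles ask for. *)
Lemma fresh_element x U (s : seq X) : open U -> U !=set0 ->
  exists2 g : F, U (g x) & g x \notin s.
Proof.
move=> oU U0; have [V [oV V0 VU Vs]] := open_avoid mu s oU U0.
by have [n Vn] := orbit_dense mu x oV V0; exists (zexpg (gen u) n); [exact: VU|exact: Vs].
Qed.

Definition cyc3 U f := exists A a b c,
  [/\ tri A a b c, forall x, A x -> [/\ U (a x), U (b x) & U (c x)] & f = cyc A a b c].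

(** Words in 3-cycles form a group since the set of 3-cycles is stable under
inversion. *)
Inductive alt U : F -> Prop :=
| alt1 : alt U 1
| altM f g : cyc3 U f -> alt U g -> alt U (f * g).

Lemma cyc3V U f : cyc3 U f -> cyc3 U f^-1.
Proof.
move=> [A [a [b [c [T AU ->]]]]]; rewrite cycV//; exists A, c, b, a; split=> //.
  exact: tri_rev.
by move=> x /AU [].
Qed.

Lemma cyc3J U k f : cyc3 U f -> cyc3 [set y | U (k^-1 y)] (k * f * k^-1).
Proof.
move=> [A [a [b [c [T AU ->]]]]]; rewrite cycJ//; exists A, (k * a), (k * b), (k * c).
split=> //; first exact: tri_mul.
by move=> x /AU [? ? ?]; split; rewrite /mkset !fullM fullKV.
Qed.

Lemma cyc3_sub U V f : U `<=` V -> cyc3 U f -> cyc3 V f.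
Proof.
move=> UV [A [a [b [c [T AU ->]]]]]; exists A, a, b, c; split=> //.
by move=> x /AU [/UV ? /UV ? /UV].
Qed.

Lemma alt_cyc3 U f : cyc3 U f -> alt U f.
Proof. by move=> cf; rewrite -[f]mulg1; apply: altM => //; exact: alt1. Qed.

Lemma alt_mul U f g : alt U f -> alt U g -> alt U (f * g).
Proof.
move=> af ag; elim: af => [|c f' cc _ IH]; first by rewrite mul1g.
by rewrite -mulgA; exact: altM.
Qed.

Lemma alt_inv U f : alt U f -> alt U f^-1.
Proof.
elim=> [|c f' /cyc3V/alt_cyc3 cc _ IH]; first by rewrite invg1; exact: alt1.
by rewrite invgM; exact: alt_mul.
Qed.

Lemma alt_sub U V f : U `<=` V -> alt U f -> alt V f.
Proof.
move=> UV; elim=> [|c f' cc _ IH]; first exact: alt1.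
by apply: altM => //; exact: cyc3_sub cc.
Qed.

Lemma altJ U k f : alt U f -> alt [set y | U (k^-1 y)] (k * f * k^-1).
Proof.
elim=> [|c f' cc _ IH]; first by rewrite mulg1 mulgV; exact: alt1.
have -> : k * (c * f') * k^-1 = (k * c * k^-1) * (k * f' * k^-1).
  by rewrite !mulgA mulgVK.
by apply: altM => //; exact: cyc3J.
Qed.

Lemma cyc3_out U f y : cyc3 U f -> ~ U y -> f y = y.
Proof.
move=> [A [a [b [c [T AU ->]]]]] nUy; have [_ _ _ H] := cycP T.
by apply: H => x /AU [Ua Ub Uc]; split=> E; apply: nUy; rewrite E.
Qed.

Lemma alt_out U f y : alt U f -> ~ U y -> f y = y.
Proof.
move=> af nUy; elim: af => [//|c f' cc _ IH].
by rewrite fullM IH; exact: cyc3_out cc nUy.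
Qed.

Lemma alt_stable U f y : alt U f -> U y -> U (f y).
Proof.
move=> af Uy; apply: contrapT => nU; have := alt_out (alt_inv af) nU.
by rewrite fullKV => E; apply: nU; rewrite -E.
Qed.

Lemma alt_conj U k f : alt U k -> alt U f -> alt U (k * f * k^-1).
Proof. by move=> ak af; apply: alt_mul; [exact: alt_mul|exact: alt_inv]. Qed.

Lemma alt_commute U V f g : alt U f -> alt V g -> U `&` V = set0 -> f * g = g * f.
Proof.
move=> af ag UV; apply: full_ext => y; rewrite !fullM.
have UVn z : U z -> ~ V z by move=> Uz Vz; have : (U `&` V) z by []; rewrite UV.
have [Uy|nUy] := pselect (U y).
  rewrite (alt_out ag (UVn _ Uy)) (alt_out ag)//.
  by apply: UVn; exact: alt_stable.
rewrite [f y](alt_out af nUy); have [Vy|nVy] := pselect (V y).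
  by rewrite (alt_out af)// => /UVn; apply; exact: alt_stable.
by rewrite (alt_out ag nVy) (alt_out af nUy).
Qed.

End Alternating.

(** * Generation and simplicity of the alternating groups *)
Section Simplicity.
Variables (X : topologicalType) (u : homeo X) (mu : cantor_minimal u).
Notation F := (full_group u).
Implicit Types (a b c d e f g h k : F) (x y z : X) (A B U V : set X).

Lemma frame_sub A (s : seq F) (l : seq nat) : uniq l -> all (fun i => (i < size s)%N) l ->
  frame A s -> frame A [seq nth 1 s i | i <- l].
Proof.
move=> ul /allP sl fr i j; rewrite size_map => /andP[/andP[ij il] jl].
rewrite !(nth_map 0%N)//; apply: fr; rewrite nth_uniq// ij /=.
by rewrite !sl// mem_nth.
Qed.

Lemma frame_tri A a b c : clopen A -> frame A [:: a; b; c] -> tri A a b c.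
Proof.
move=> cA fr; split=> //; first exact: (fr 0%N 1%N isT).
  exact: (fr 1%N 2%N isT).
exact: (fr 0%N 2%N isT).
Qed.

(** A 3-cycle is the product of its restrictions to the pieces of a partition of
its base. *)
Lemma cyc_local_global (N : F -> Prop) A a b c : N 1 ->
  (forall f g, N f -> N g -> N (f * g)) -> tri A a b c ->
  (forall x, A x -> germ x (fun B => N (cyc B a b c))) -> N (cyc A a b c).
Proof.
move=> N1 NM T Nx.
suff : A `<=` A -> N (cyc A a b c) by exact.
apply: (clopen_local mu (J := fun B => B `<=` A -> N (cyc B a b c))) => //.
- exact: tri_clopen T.
- move=> _; have T0 : tri set0 a b c by apply: tri_sub T => //; exact: clopen0.
  suff -> : cyc set0 a b c = 1 by [].
  by have [_ _ _ H] := cycP T0; apply: full_ext => y; rewrite H.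
- move=> B C cB cC BC0 BCA JB JC _; rewrite cycU//.
    by apply: (NM); [apply: JB|apply: JC] => y ?; apply: BCA; [left|right].
  by apply: tri_sub T => //; exact: clopenU.
- by move=> x /Nx; apply: germ_imp.
Qed.

(** Conjugating by the 3-cycle (q p e) relabels q as p. *)
Lemma cyc_replace (N : F -> Prop) A V p q e r1 r2 :
  clopen A -> frame A [:: p; q; e; r1; r2] ->
  (forall x, A x -> [/\ V (p x), V (q x) & V (e x)]) ->
  (forall k f, alt V k -> N f -> N (k * f * k^-1)) ->
  N (cyc A q r1 r2) -> N (cyc A p r1 r2).
Proof.
move=> cA fr AV NV Nq.
have T1 : tri A q r1 r2.
  by apply: frame_tri => //; exact: (@frame_sub _ _ [:: 1; 3; 4]%N _ _ fr).
have T2 : tri A q p e.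
  by apply: frame_tri => //; exact: (@frame_sub _ _ [:: 1; 0; 2]%N _ _ fr).
have T3 : tri A p r1 r2.
  by apply: frame_tri => //; exact: (@frame_sub _ _ [:: 0; 3; 4]%N _ _ fr).
have [k1 k2 k3 k4] := cycP T2.
have -> : cyc A p r1 r2 = cyc A q p e * cyc A q r1 r2 * (cyc A q p e)^-1.
  rewrite cycJ//; apply: cyc_local => // x Ax; split.
  - by rewrite fullM k1.
  - rewrite fullM k4// => y Ay; split.
    + exact: (fr 3%N 1%N isT).
    + exact: (fr 3%N 0%N isT).
    + exact: (fr 3%N 2%N isT).
  - rewrite fullM k4// => y Ay; split.
    + exact: (fr 4%N 1%N isT).
    + exact: (fr 4%N 0%N isT).
    + exact: (fr 4%N 2%N isT).
apply: NV => //; apply: alt_cyc3; exists A, q, p, e; split=> // x /AV [].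
by split.
Qed.

(** Near each base point, conjugation moves the three levels of a 3-cycle in U one
by one into B, where the orbit provides enough free points.  Each step uses a
3-cycle supported by B and a neighbourhood of one level only; so it is enough
that each point of U has a neighbourhood V for which alt V normalizes N. *)
Lemma alt_spread U B (N : F -> Prop) : clopen B -> B !=set0 ->
  N 1 -> (forall f g, N f -> N g -> N (f * g)) ->
  (forall x, U x -> exists V, [/\ clopen V, V x, B `<=` V &
     forall k f, alt V k -> N f -> N (k * f * k^-1)]) ->
  (forall f, cyc3 B f -> N f) -> forall f, alt U f -> N f.
Proof.
move=> cB B0 N1 NM NV NB f; elim=> // {}f g cf _ Ng; apply: (NM) => // {g Ng}.
move: cf => [A [a [b [c [T AU ->]]]]].
apply: cyc_local_global => // x Ax; have [Ua Ub Uc] := AU x Ax.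
have oB : open B by case: cB.
have [V1 [cV1 V1x BV1 NV1]] := NV _ Ua.
have [V2 [cV2 V2x BV2 NV2]] := NV _ Ub.
have [V3 [cV3 V3x BV3 NV3]] := NV _ Uc.
have [b1 B1 n1] := fresh_element mu x [:: a x; b x; c x] oB B0.
have [b2 B2 n2] := fresh_element mu x [:: b1 x; a x; b x; c x] oB B0.
have [b3 B3 n3] := fresh_element mu x [:: b2 x; b1 x; a x; b x; c x] oB B0.
have [e Be ne] := fresh_element mu x [:: b3 x; b2 x; b1 x; a x; b x; c x] oB B0.
have [cA ab bc ac] := T.
have G1 : germ x (fun D => frame D [:: e; b3; b2; b1; a; b; c]).
  apply: (germ_frame mu).
  rewrite map_cons cons_uniq ne map_cons cons_uniq n3 map_cons cons_uniq n2.
  rewrite map_cons cons_uniq n1 /= !inE !negb_or !andbT.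
  by apply/andP; split; [apply/andP; split|]; apply/eqP; [exact: ab|exact: ac|exact: bc].
have G2 := germ_and (germ_clopen (clopen_preimage a cV1) V1x)
  (germ_and (germ_clopen (clopen_preimage b cV2) V2x) (germ_clopen (clopen_preimage c cV3) V3x)).
have G3 := germ_and (germ_clopen (clopen_preimage b1 cB) B1)
  (germ_and (germ_clopen (clopen_preimage b2 cB) B2)
    (germ_and (germ_clopen (clopen_preimage b3 cB) B3) (germ_clopen (clopen_preimage e cB) Be))).
apply: germ_imp (germ_and G1 (germ_and G2 G3)) => D cD [fr [[HV1 [HV2 HV3]] [H1 [H2 [H3 He]]]]].
apply: (cyc_replace (V := V1) (q := b1) (e := e) cD _ _ NV1).
- exact: (@frame_sub _ _ [:: 4; 3; 0; 5; 6]%N _ _ fr).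
- by move=> z Dz; split; [exact: HV1|exact/BV1/H1|exact/BV1/He].
rewrite cyc_rot; last first.
  by apply: frame_tri => //; exact: (@frame_sub _ _ [:: 3; 5; 6]%N _ _ fr).
apply: (cyc_replace (V := V2) (q := b2) (e := e) cD _ _ NV2).
- exact: (@frame_sub _ _ [:: 5; 2; 0; 6; 3]%N _ _ fr).
- by move=> z Dz; split; [exact: HV2|exact/BV2/H2|exact/BV2/He].
rewrite cyc_rot; last first.
  by apply: frame_tri => //; exact: (@frame_sub _ _ [:: 2; 6; 3]%N _ _ fr).
apply: (cyc_replace (V := V3) (q := b3) (e := e) cD _ _ NV3).
- exact: (@frame_sub _ _ [:: 6; 1; 0; 3; 2]%N _ _ fr).
- by move=> z Dz; split; [exact: HV3|exact/BV3/H3|exact/BV3/He].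
apply: NB; exists D, b3, b1, b2; split=> //.
  by apply: frame_tri => //; exact: (@frame_sub _ _ [:: 1; 3; 2]%N _ _ fr).
by move=> z Dz; split; [exact: H3|exact: H1|exact: H2].
Qed.

Lemma alt_union U V (N : F -> Prop) : clopen U -> clopen V -> U `&` V !=set0 ->
  N 1 -> (forall f g, N f -> N g -> N (f * g)) ->
  (forall f, alt U f -> N f) -> (forall f, alt V f -> N f) ->
  forall f, alt (U `|` V) f -> N f.
Proof.
move=> cU cV UV N1 NM NU NV.
apply: (alt_spread (B := U `&` V)) => //; first exact: clopenI.
  move=> x [Ux|Vx]; [exists U|exists V]; split=> //; try by move=> y [].
    by move=> k f ak Nf; apply: (NM); [apply: NM => //; exact: NU|exact/NU/alt_inv].
  by move=> k f ak Nf; apply: (NM); [apply: NM => //; exact: NV|exact/NV/alt_inv].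
by move=> f /alt_cyc3 af; apply: NU; apply: alt_sub af => y [].
Qed.

(** In labels: (b c d)(a d c) = (b c)(c d)(d c)(c a) = (b c)(c a). *)
Lemma cyc_mul A a b c d : clopen A -> frame A [:: a; b; c; d] ->
  cyc A b c d * cyc A a d c = cyc A a b c.
Proof.
move=> cA fr.
have Tadc : tri A a d c.
  by apply: frame_tri => //; exact: (@frame_sub _ _ [:: 0; 3; 2]%N _ _ fr).
have Tabc : tri A a b c.
  by apply: frame_tri => //; exact: (@frame_sub _ _ [:: 0; 1; 2]%N _ _ fr).
rewrite (cyc_rot Tadc) (cyc_rot Tabc) /cyc.
have ap : apart A c d by exact: (fr 2%N 3%N isT).
have ca : clopen A by [].
rewrite (swapC ca (apart_sym ap)) -mulgA (mulgA (swap A c d)) swapK//.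
by rewrite mul1g.
Qed.

(** (a b c) is the commutator of (a b e) and (a c d), for two free labels d, e. *)
Lemma alt_perfect B (N : F -> Prop) : clopen B ->
  N 1 -> (forall f g, N f -> N g -> N (f * g)) ->
  (forall f g, alt B f -> alt B g -> N (f * g * f^-1 * g^-1)) ->
  forall f, alt B f -> N f.
Proof.
move=> cB N1 NM NC f; elim=> // {}f g cf _ Ng; apply: (NM) => // {g Ng}.
move: cf => [A [a [b [c [T AU ->]]]]].
apply: cyc_local_global => // x Ax; have [Ua Ub Uc] := AU x Ax.
have oB : open B by case: cB.
have B0 : B !=set0 by exists (a x).
have [d Bd nd] := fresh_element mu x [:: a x; b x; c x] oB B0.
have [e Be ne] := fresh_element mu x [:: d x; a x; b x; c x] oB B0.
have [cA ab bc ac] := T.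
have G1 : germ x (fun D => frame D [:: e; d; a; b; c]).
  apply: (germ_frame mu).
  rewrite map_cons cons_uniq ne map_cons cons_uniq nd /= !inE !negb_or !andbT.
  by apply/andP; split; [apply/andP; split|]; apply/eqP; [exact: ab|exact: ac|exact: bc].
have G2 := germ_and (germ_clopen (clopen_preimage a cB) Ua)
  (germ_and (germ_clopen (clopen_preimage b cB) Ub) (germ_clopen (clopen_preimage c cB) Uc)).
have G3 := germ_and (germ_clopen (clopen_preimage d cB) Bd) (germ_clopen (clopen_preimage e cB) Be).
apply: germ_imp (germ_and G1 (germ_and G2 G3)) => D cD [fr [[Ha [Hb Hc]] [Hd He]]].
have T1 : tri D a c d.
  by apply: frame_tri => //; exact: (@frame_sub _ _ [:: 2; 4; 1]%N _ _ fr).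
have T2 : tri D a b e.
  by apply: frame_tri => //; exact: (@frame_sub _ _ [:: 2; 3; 0]%N _ _ fr).
have T3 : tri D b c d.
  by apply: frame_tri => //; exact: (@frame_sub _ _ [:: 3; 4; 1]%N _ _ fr).
have [k1 k2 k3 k4] := cycP T2.
have -> : cyc D a b c =
    cyc D a b e * cyc D a c d * (cyc D a b e)^-1 * (cyc D a c d)^-1.
  rewrite cycJ// cycV//.
  have -> : cyc D (cyc D a b e * a) (cyc D a b e * c) (cyc D a b e * d) = cyc D b c d.
    apply: cyc_local; first exact: tri_mul.
    move=> y Dy; split; rewrite fullM ?k1//; apply: k4 => z Dz; split.
    + exact: (fr 4%N 2%N isT).
    + exact: (fr 4%N 3%N isT).
    + exact: (fr 4%N 0%N isT).
    + exact: (fr 1%N 2%N isT).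
    + exact: (fr 1%N 3%N isT).
    + exact: (fr 1%N 0%N isT).
  rewrite -(@cyc_mul _ a b c d)//.
    by congr (_ * _); apply: cyc_rot; apply/tri_rot/tri_rot; exact: tri_rev.
  exact: (@frame_sub _ _ [:: 2; 3; 4; 1]%N _ _ fr).
apply: NC; apply: alt_cyc3.
  by exists D, a, b, e; split=> // y Dy; split; [exact: Ha|exact: Hb|exact: He].
by exists D, a, c, d; split=> // y Dy; split; [exact: Ha|exact: Hc|exact: Hd].
Qed.

(** If n moves B off itself, then n f n^-1 commutes with alt B for f in alt B; so
the double commutator of n, f and g is a commutator of alt B.  Hence N contains
the perfect group alt B, and then all of alt U by spreading. *)
Lemma alt_simple U (N : F -> Prop) n : clopen U ->
  N 1 -> (forall f g, N f -> N g -> N (f * g)) -> (forall f, N f -> N f^-1) ->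
  (forall k f, alt U k -> N f -> N (k * f * k^-1)) ->
  alt U n -> N n -> n <> 1 -> forall f, alt U f -> N f.
Proof.
move=> cU N1 NM NI NJ an Nn n1.
have [y ny] : exists y, n y <> (1 : F) y.
  apply: contrapT => H; apply: n1; apply: full_ext => y.
  by apply: contrapT => ny; apply: H; exists y.
have Uy : U y by apply: contrapT => nU; apply: ny; rewrite (alt_out an).
have := germ_and (germ_apart mu ny) (germ_clopen cU Uy).
move=> /germ_witness [B [cB By [nB BU]]].
apply: (alt_spread (B := B)) => //; first by exists y.
  by move=> x Ux; exists U; split.
move=> f /alt_cyc3; apply: (alt_perfect cB) => //.
suff H f' g : alt B f' -> alt B g -> N (f'^-1 * g * f' * g^-1).
  move=> f1 g af ag; rewrite -{1}[f1]invgK; apply: H => //; exact: alt_inv.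
move=> af ag; have [p pE] : exists p, p = n * f' * n^-1 by exists (n * f' * n^-1).
have ap : alt [set z | B (n^-1 z)] p by rewrite pE; exact: altJ.
have disj : [set z | B (n^-1 z)] `&` B = set0.
  rewrite predeqE => z; split=> // -[/= B1 B2].
  by have := nB _ _ B1 B2; rewrite fullVK.
have pf : p * f' = f' * p by exact: alt_commute ap af disj.
have pg : p * g = g * p by exact: alt_commute ap ag disj.
have am : N (p * f'^-1).
  have := NM _ _ Nn (NJ f' _ (alt_sub BU af) (NI _ Nn)).
  by rewrite !mulgA -pE.
have := NM _ _ am (NJ g _ (alt_sub BU ag) (NI _ am)).
rewrite invgM invgK !mulgA.
suff -> : p * f'^-1 * g * f' * p^-1 * g^-1 = f'^-1 * g * f' * g^-1 by [].
have pfV : p * f'^-1 = f'^-1 * p.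
  by apply: (mulgI f'); rewrite !mulgA mulgV mul1g -pf mulgK.
by rewrite pfV -(mulgA f'^-1 p) pg mulgA -(mulgA _ p) pf mulgA mulgK.
Qed.

End Simplicity.

(** * First-return maps *)
Section Derived.
Variables (X : topologicalType) (u : homeo X) (mu : cantor_minimal u).
Notation F := (full_group u).
Notation T n := (zexpg (gen u) n).
Implicit Types (a b c d e f g h k : F) (x y z : X) (A B U V Y : set X).

Lemma visit_bound Y : open Y -> Y !=set0 ->
  exists M : nat, forall x, exists2 n : int, (`|n| <= M)%N & Y (T n x).
Proof.
move=> oY Y0.
pose J A := exists M : nat, forall x, A x -> exists2 n : int, (`|n| <= M)%N & Y (T n x).
have [||A B [c Hc] [d Hd]|x _|A TA [c Hc]] := @compact_ideal X setT J.
- exact: cantor_minimal_compact mu.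
- by exists 0%N.
- exists (maxn c d) => x [/Hc|/Hd] [n nc gn]; exists n => //; lia.
- have [n Yn] := orbit_dense mu x oY Y0.
  exists (T n @^-1` Y); split=> //; last by exists `|n|%N => y Yy; exists n.
  by apply: open_comp => // y _; exact: full_continuous.
- by exists c => x; apply: Hc; exact: TA.
Qed.

(** Orbits visit Y within a bounded time, in either direction; translating the
starting point makes the time positive. *)
Lemma forward_visit Y : open Y -> Y !=set0 ->
  exists M : nat, forall x, exists n : nat, [/\ (0 < n)%N, (n <= M)%N & Y (T (Posz n) x)].
Proof.
move=> oY Y0; have [M HM] := visit_bound oY Y0.
exists (M.+1 + M)%N => x; have [n nM Yn] := HM (T (Posz M.+1) x).
exists `|(n + Posz M.+1)%R|%N; split; try lia.
have -> : (`|(n + Posz M.+1)%R|%N : int) = (n + (Posz M.+1))%R by lia.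
by rewrite zexpgDE.
Qed.

Lemma backward_visit Y : open Y -> Y !=set0 ->
  forall x, exists n : nat, (0 < n)%N /\ Y (T (- (Posz n))%R x).
Proof.
move=> oY Y0 x; have [M HM] := visit_bound oY Y0.
have [n nM Yn] := HM (T (- (Posz M.+1))%R x).
exists `|(Posz M.+1 - n)%R|%N; split; try lia.
have -> : (- (`|(Posz M.+1 - n)%R|%N : int) = n - (Posz M.+1))%R by lia.
by rewrite zexpgDE.
Qed.

Definition next_visit Y x (m : nat) y := [/\ Y x, Y y, (0 < m)%N, y = T (Posz m) x &
  forall j : nat, (0 < j)%N -> (j < m)%N -> ~ Y (T (Posz j) x)].

Lemma next_visit_fun Y x m m' y y' :
  next_visit Y x m y -> next_visit Y x m' y' -> y = y'.
Proof.
move=> [_ Yy m0 yE nm] [_ Yy' m0' yE' nm'].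
have [mm|mm|mm] := ltngtP m m'.
- by case: (nm' m m0 mm); rewrite -yE.
- by case: (nm m' m0' mm); rewrite -yE'.
- by rewrite yE yE' mm.
Qed.

Lemma next_visit_inj Y x x' m m' y :
  next_visit Y x m y -> next_visit Y x' m' y -> x = x'.
Proof.
move=> [Yx _ m0 yE nm] [Yx' _ m0' yE' nm'].
have xx' : x' = T ((Posz m) - (Posz m'))%R x.
  by rewrite GRing.addrC zexpgDE -yE yE' -zexpgDE GRing.addNr.
have [mm|mm|mm] := ltngtP m m'.
- case: (nm' (m' - m)%N); try lia.
  have -> : Posz (m' - m)%N = (- ((Posz m) - (Posz m')))%R by lia.
  by rewrite xx' -zexpgDE GRing.addNr.
- case: (nm (m - m')%N); try lia.
  have -> : Posz (m - m')%N = ((Posz m) - (Posz m'))%R by lia.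
  by rewrite -xx'.
- by rewrite xx' mm GRing.subrr.
Qed.

Lemma next_visit_exists Y M x : Y x -> (exists n : nat, [/\ (0 < n)%N, (n <= M)%N & Y (T (Posz n) x)]) ->
  exists m y, next_visit Y x m y /\ (m <= M)%N.
Proof.
move=> Yx [n [n0 nM Yn]].
have ex : exists n : nat, (0 < n)%N && `[< Y (T (Posz n) x) >].
  by exists n; rewrite n0; exact/asboolP.
case: (ex_minnP ex) => m /andP[m0 /asboolP Ym] Hm.
exists m, (T (Posz m) x); split; last first.
  by apply: leq_trans nM; apply: Hm; rewrite n0; exact/asboolP.
split=> // j j0 jm Yj.
by have : (m <= j)%N; [apply: Hm; rewrite j0; exact/asboolP|rewrite leqNgt jm].
Qed.

Lemma prev_visit_exists Y y : Y y -> (exists n : nat, (0 < n)%N /\ Y (T (- (Posz n))%R y)) ->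
  exists m x, next_visit Y x m y.
Proof.
move=> Yy [n [n0 Yn]].
have ex : exists n : nat, (0 < n)%N && `[< Y (T (- (Posz n))%R y) >].
  by exists n; rewrite n0; exact/asboolP.
case: (ex_minnP ex) => m /andP[m0 /asboolP Ym] Hm.
exists m, (T (- (Posz m))%R y); split=> //.
  by rewrite -zexpgDE GRing.subrr.
move=> j j0 jm; rewrite -zexpgDE => Yj.
have : (m <= m - j)%N; last lia.
apply: Hm; apply/andP; split; first lia.
apply/asboolP; have -> : (- Posz (m - j)%N = (Posz j) - (Posz m))%R by lia.
exact: Yj.
Qed.

Definition is_return Y f := (forall x m y, next_visit Y x m y -> f x = y) /\
  (forall x, ~ Y x -> f x = x).

(** The first-return map is the inverse of the last-visit map; return times are
locally constant since they are decided by finitely many clopen conditions. *)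
Lemma return_exists Y : clopen Y -> Y !=set0 -> exists f, is_return Y f.
Proof.
move=> cY Y0; have oY : open Y by case: cY.
have [M HM] := forward_visit oY Y0.
pose r x := xget x [set y | exists m, next_visit Y x m y].
pose r' y := xget y [set x | exists m, next_visit Y x m y].
have rE x m y : next_visit Y x m y -> r x = y.
  move=> H; have [m' H'] : exists m', next_visit Y x m' (r x).
    by apply: (@xgetPex _ x [set y | exists m, next_visit Y x m y]); exists y, m.
  exact: next_visit_fun H' H.
have rE' x m y : next_visit Y x m y -> r' y = x.
  move=> H; have [m' H'] : exists m', next_visit Y (r' y) m' y.
    by apply: (@xgetPex _ y [set x | exists m, next_visit Y x m y]); exists x, m.
  exact: next_visit_inj H' H.
have rN x : ~ Y x -> r x = x.
  by move=> nY; rewrite /r xgetPN// => y [m []].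
have rN' x : ~ Y x -> r' x = x.
  by move=> nY; rewrite /r' xgetPN// => y [m []].
have [||x|f fr] := @full_paste _ u r r'.
- move=> x; have [Yx|nY] := pselect (Y x); last by rewrite rN ?rN'.
  have [m [y [H _]]] := next_visit_exists Yx (HM x).
  by rewrite (rE _ _ _ H) (rE' _ _ _ H).
- move=> y; have [Yy|nY] := pselect (Y y); last by rewrite rN' ?rN.
  have [m [x H]] := prev_visit_exists Yy (backward_visit oY Y0 y).
  by rewrite (rE' _ _ _ H) (rE _ _ _ H).
- have [Yx|nY] := pselect (Y x); last first.
    exists 1, (~` Y); split=> //; by apply: closed_openC; case: cY.
  have [m [y [[_ Yy m0 yE Hm] _]]] := next_visit_exists Yx (HM x).
  have G : germ x (fun A => forall j, j \in iota 1 m.-1 ->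
      forall z, A z -> (~` (T (Posz j) @^-1` Y)) z).
    apply: (@germ_all _ _ _ _ (fun j A => forall z, A z -> (~` (T (Posz j) @^-1` Y)) z)).
    move=> j; rewrite mem_iota => jm; apply: germ_clopen.
      by apply: clopenC => //; exact: clopen_preimage.
    by apply: Hm; lia.
  have cYm := clopen_preimage (T (Posz m)) cY.
  rewrite yE in Yy.
  have := germ_and G (germ_and (germ_clopen cY Yx) (germ_clopen cYm Yy)).
  move=> /germ_witness [A [[oA _] Ax [HA [AY AYm]]]].
  exists (T (Posz m)), A; split=> // z Az; apply: (rE _ m); split=> //.
  + exact: AY.
  + exact: AYm.
  + by move=> j j0 jm; apply: HA => //; rewrite mem_iota; lia.
by exists f; split=> [x m y H|x nY]; rewrite fr; [exact: rE H|exact: rN].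
Qed.

End Derived.

(** * The derived group is generated by 3-cycles *)
Section Generation.
Variables (X : topologicalType) (u : homeo X) (mu : cantor_minimal u).
Notation F := (full_group u).
Notation T n := (zexpg (gen u) n).
Implicit Types (a b c d e f g h k s w : F) (x y z : X) (A B U V Y : set X).

Lemma return_in Y f x : clopen Y -> is_return Y f -> Y x ->
  exists m : nat, [/\ (0 < m)%N, f x = T (Posz m) x & next_visit u Y x m (f x)].
Proof.
move=> cY [fr _] Yx; have oY : open Y by case: cY.
have Y0 : Y !=set0 by exists x.
have [M HM] := forward_visit mu oY Y0.
have [m [y [H _]]] := next_visit_exists Yx (HM x).
have fx := fr _ _ _ H; exists m; rewrite fx; split=> //; by case: H.
Qed.

(** If B is so small that an orbit visits Y between two visits to B, adding B to Y
changes the first-return map by the swap of B with its predecessors: y -> b ->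
y' replaces y -> y'. *)
Lemma return_addition Y B f w M : clopen Y -> clopen B -> Y !=set0 -> Y `&` B = set0 ->
  (forall x, exists n : nat, [/\ (0 < n)%N, (n <= M)%N & Y (T (Posz n) x)]) ->
  (forall m : nat, (0 < m)%N -> (m <= M)%N -> apart B 1 (T (Posz m))) ->
  is_return Y f -> is_return (Y `|` B) w ->
  apart B 1 w^-1 /\ w = f * swap B 1 w^-1.
Proof.
move=> cY cB Y0 YB0 HM apB [fr fo] [wr wo].
have YB x : Y x -> ~ B x by move=> Yx Bx; have : (Y `&` B) x by []; rewrite YB0.
have visit x : (Y `|` B) x -> exists m, next_visit u (Y `|` B) x m (w x) /\ (m <= M)%N.
  move=> YBx; have [|m [y [H mM]]] := @next_visit_exists _ u (Y `|` B) M x YBx.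
    by have [n [n0 nM Yn]] := HM x; exists n; split=> //; left.
  by exists m; rewrite (wr _ _ _ H).
have wB x : B x -> ~ B (w x).
  move=> Bx Bwx; have [|m [[_ _ m0 wE _] mM]] := visit x; first by right.
  by apply: (apB m m0 mM _ _ Bwx Bx); rewrite -wE.
have ap : apart B 1 w^-1.
  by move=> y x By Bx E; apply: (wB y) => //; rewrite [y in w y]E fullVK.
split=> //; apply: full_ext => z; rewrite fullM.
have [s1 s2 s3] := swapP cB ap.
have wYB x : (Y `|` B) x -> (Y `|` B) (w x) by move=> /visit [m [[]]].
have wVYB x : (Y `|` B) x -> (Y `|` B) (w^-1 x).
  move=> YBx; apply: contrapT => n; apply: (n).
  by have := wo _ n; rewrite fullVK => <-.
have [[x Bx ->]|nB] := level_cases B (1 : F) z.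
  rewrite s1//; apply/esym.
  have [|m [[_ _ m0 wE wn] _]] := visit x; first by right.
  (* the return to Y from the predecessor of x passes through x *)
  have [|m' [[YBv _ m0' wE' wn'] _]] := visit (w^-1 x).
    by apply: wVYB; right.
  rewrite fullVK in wE'.
  apply: (fr _ (m' + m)%N); split; last 1 first.
  - move=> j j0 jmm.
    have [jm|jm|jm] := ltngtP j m'; last by rewrite jm -wE'; exact: (@contraPnot _ _ (YB x)).
      by have := wn' j j0 jm; apply: contra_not; left.
    have -> : Posz j = (Posz (j - m')%N + Posz m')%R by lia.
    rewrite zexpgDE -wE' => Yj; apply: (wn (j - m')%N); try lia.
    by left.
  - case: YBv => // Bv; exfalso; have := wB _ Bv; rewrite fullVK; exact.
  - by case: (wYB x) => [|//|/(wB x)//]; right.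
  - lia.
  - have -> : Posz (m' + m)%N = (Posz m + Posz m')%R by lia.
    by rewrite zexpgDE -wE'.
have [[x Bx ->]|nwB] := level_cases B w^-1 z.
  by rewrite s2// fullVK fo//; move=> /YB; exact.
rewrite s3; last by move=> x Bx; split; [exact: nB|exact: nwB].
have [Yz|nY] := pselect (Y z); last first.
  by rewrite fo// wo// => -[//|Bz]; apply: (nB z).
have [|m [[_ YBw m0 wE wn] _]] := visit z; first by left.
apply/esym; apply: (fr _ m); split=> //.
  by case: YBw => // Bw; case: (nwB _ Bw); rewrite fullKV.
by move=> j j0 jm Yj; apply: (wn j) => //; left.
Qed.

Lemma is_return_ext Y f g : clopen Y -> is_return Y f -> is_return Y g -> f = g.
Proof.
move=> cY rf rg; apply: full_ext => x.
have [Yx|nY] := pselect (Y x); last by rewrite rf.2// rg.2.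
by have [m [_ _ H]] := return_in cY rf Yx; rewrite (rg.1 _ _ _ H).
Qed.

Lemma gen_return : is_return setT (gen u).
Proof.
split=> [x m y [_ _ m0 -> H]|x]; last by case.
suff -> : m = 1%N by [].
have [|m1] := leqP m 1; first by case: m m0 {H} => [|[|]].
by case: (H 1%N).
Qed.

Section Generated.
Variable N : F -> Prop.
Hypotheses (NM : forall f g, N f -> N g -> N (f * g)) (NI : forall f, N f -> N f^-1).
Hypotheses (Ngen : N (gen u)) (Nswap : forall A a b, clopen A -> apart A a b -> N (swap A a b)).

(** Starting from Y, small sets are added until the whole space is reached, where
the first-return map is u. *)
Lemma return_generated Y f : clopen Y -> Y !=set0 -> is_return Y f -> N f.
Proof.
move=> cY Y0 rf; have oY : open Y by case: cY.
pose J B := forall Y' f w, clopen Y' -> Y `<=` Y' -> is_return Y' f ->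
  is_return (Y' `|` B) w -> N w -> N f.
suff : J setT by move=> /(_ Y f (gen u)); rewrite setUT; apply=> //; exact: gen_return.
apply: (clopen_local mu (A := setT)).
- exact: clopenT.
- by move=> Y' g w cY' _ rg; rewrite setU0 => rw; rewrite (is_return_ext cY' rg rw).
- move=> B C cB cC _ _ JB JC Y' g w cY' YY' rg rw Nw.
  have cYB : clopen (Y' `|` B) by exact: clopenU.
  have [|h rh] := return_exists mu cYB.
    by have [y Yy] := Y0; exists y; left; exact: YY'.
  apply: (JB Y' g h) => //; apply: (JC (Y' `|` B) h w) => //; last by rewrite -setUA.
  by move=> y /YY'; left.
have [M HM] := forward_visit mu oY Y0.
move=> x _.
have G : germ x (fun A => forall m, m \in iota 1 M -> apart A 1 (T (Posz m))).
  apply: (@germ_all _ _ _ _ (fun m A => apart A 1 (T (Posz m)))) => m.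
  rewrite mem_iota => mM; apply: (germ_apart mu) => /esym /(gen_free mu) /eqP; lia.
apply: germ_imp G => B cB HB Y' g w cY' YY' rg.
have -> : Y' `|` B = Y' `|` (B `&` ~` Y').
  by rewrite setUIr setUv setIT.
move=> rw Nw; have cB' : clopen (B `&` ~` Y') by apply: clopenI => //; exact: clopenC.
have [||y|m m0 mM|ap wE] := return_addition (M := M) cY' cB' _ _ _ _ rg rw.
- by have [y Yy] := Y0; exists y; exact: YY'.
- by rewrite setICA setICr setI0.
- by have [n [n0 nM Yn]] := HM y; exists n; split=> //; exact: YY'.
- by apply: apart_sub (HB m _) => [y []//|]; rewrite mem_iota; lia.
have -> : g = w * swap (B `&` ~` Y') 1 w^-1 by rewrite {1}wE -mulgA swapK// mulg1.
by apply: NM => //; exact: Nswap.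
Qed.

(** Let Y be the set moved by f.  As f maps Y to itself and moves points forward,
it jumps at least to the next point of Y; composing with the inverse of the
first-return map to Y shortens all nonzero jumps. *)
Lemma positive_generated n f :
  (forall x, exists2 k : nat, (k <= n)%N & f x = T (Posz k) x) -> N f.
Proof.
elim: n f => [|n IHn] f Hf.
  have -> : f = gen u * (gen u)^-1.
    by rewrite mulgV; apply: full_ext => x; have [[|k]] := Hf x.
  by apply: NM => //; exact: NI.
pose Y := ~` [set x | f x = (1 : F) x].
have cY : clopen Y by apply: clopenC => //; exact: (full_eq_clopen mu).
have [Y0|nY] := pselect (Y !=set0); last first.
  have -> : f = gen u * (gen u)^-1.
    rewrite mulgV; apply: full_ext => x; apply: contrapT => fx.
    by apply: nY; exists x.
  by apply: NM => //; exact: NI.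
have [r rr] := return_exists mu cY Y0.
have Nr := return_generated cY Y0 rr.
have -> : f = r * (r^-1 * f) by rewrite mulgA mulgV mul1g.
apply: NM => //; apply: IHn => x; rewrite fullM.
have [Yx|nYx] := pselect (Y x); last first.
  have fx : f x = x by apply: contrapT => ?; apply: nYx.
  by exists 0%N => //; rewrite fx -{1}(rr.2 _ nYx) fullKV.
have Yfx : Y (f x) by move=> /= /full_inj.
have [k kn fx] := Hf x.
pose z := r^-1 (f x).
have Yz : Y z.
  by apply: contrapT => nz; apply: (nz); rewrite -(rr.2 _ nz) /z fullVK.
have [m [m0 rz [_ _ _ _ Hm]]] := return_in cY rr Yz.
rewrite /z fullVK in rz; rewrite -/z.
have xz : x = T (Posz m - Posz k)%R z.
  rewrite GRing.addrC zexpgDE /z -rz fx -zexpgDE GRing.addNr.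
  by [].
have [mk|km] := leqP m k.
  exists (k - m)%N; first lia.
  have -> : Posz (k - m)%N = (- (Posz m - Posz k))%R by lia.
  by rewrite {1}xz -zexpgDE GRing.addNr.
have k0 : (0 < k)%N by case: k fx {kn xz km} => // fx; case: Yx.
case: (Hm (m - k)%N); try lia.
have -> : Posz (m - k)%N = (Posz m - Posz k)%R by lia.
by rewrite -xz.
Qed.

(** Composing with a large power of u makes all jumps nonnegative. *)
Lemma full_generated f : N f.
Proof.
have Nn (n : nat) : N (T (Posz n)).
  elim: n => [|n IHn] /=; first by rewrite expg0 -(mulgV (gen u)); apply: NM => //; exact: NI.
  by rewrite expgS; exact: NM.
have [c Hc] := displacement_bounded mu f.
have -> : f = (T (Posz c))^-1 * (T (Posz c) * f) by rewrite mulgA mulVg mul1g.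
apply: NM; first exact: NI.
apply: (@positive_generated (c + c)%N) => x; have [n nc fx] := Hc x.
exists (`|(Posz c + n)%R|%N); first lia.
have -> : Posz `|(Posz c + n)%R|%N = (Posz c + n)%R by lia.
by rewrite fullM fx -zexpgDE.
Qed.

End Generated.

(** (a b)(c d) = (a b)(b c) (b c)(c d). *)
Lemma double_swap U A a b c d : clopen A -> frame A [:: a; b; c; d] ->
  (forall x, A x -> [/\ U (a x), U (b x), U (c x) & U (d x)]) ->
  alt U (swap A a b * swap A c d).
Proof.
move=> cA fr AU.
have bc : apart A b c by exact: (fr 1%N 2%N isT).
have -> : swap A a b * swap A c d = cyc A a b c * cyc A b c d.
  by rewrite /cyc -mulgA (mulgA (swap A b c)) swapK// mul1g.
apply: alt_mul; apply: alt_cyc3.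
  exists A, a, b, c; split=> // [|x /AU []//].
  by apply: frame_tri => //; exact: (@frame_sub _ _ _ _ [:: 0; 1; 2]%N _ _ fr).
exists A, b, c, d; split=> // [|x /AU []//].
by apply: frame_tri => //; exact: (@frame_sub _ _ _ _ [:: 1; 2; 3]%N _ _ fr).
Qed.

Lemma altTJ k f : alt setT f -> alt setT (k * f * k^-1).
Proof. by move=> /(altJ k); exact: alt_sub. Qed.

(** A product of two transpositions of points of one orbit is even.  When they
overlap, both are compared with a third one that is disjoint from them. *)
Lemma swap_commutator A g h b : clopen A -> apart A g h ->
  alt setT (swap A g h * b * (swap A g h)^-1 * b^-1).
Proof.
move=> cA gh.
suff : A `<=` A -> alt setT (swap A g h * b * (swap A g h)^-1 * b^-1) by exact.
apply: (clopen_local mu (J := fun B => B `<=` A ->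
  alt setT (swap B g h * b * (swap B g h)^-1 * b^-1))) => //.
- move=> _; have gh0 : apart set0 g h by [].
  have -> : swap set0 g h = 1.
    have [_ _ H] := swapP clopen0 gh0; apply: full_ext => y.
    by rewrite H.
  by rewrite mul1g invg1 mulg1 mulgV; exact: alt1.
- move=> B C cB cC BC0 BCA JB JC _.
  rewrite swapU//; last exact: apart_sub gh.
  set p := swap B g h; set q := swap C g h.
  have -> : p * q * b * (p * q)^-1 * b^-1 =
      p * (q * b * q^-1 * b^-1) * p^-1 * (p * b * p^-1 * b^-1).
    by rewrite invgM !mulgA mulgVK mulgVK.
  apply: alt_mul; first by apply: altTJ; apply: JC => y ?; apply: BCA; right.
  by apply: JB => y ?; apply: BCA; left.
move=> x Ax.
have [r _ nr] := fresh_element mu x [:: g x; h x; b (g x); b (h x)] openT (ex_intro _ x I).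
have [r' _ nr'] := fresh_element mu x [:: r x; g x; h x; b (g x); b (h x)] openT (ex_intro _ x I).
have ghx := gh x x Ax Ax.
have G1 : germ x (fun D => frame D [:: r'; r; g; h]).
  apply: (germ_frame mu) => /=; move: nr nr'; rewrite !inE !negb_or.
  move=> /and4P[-> -> _ _] /and5P[-> -> -> _ _] /=; rewrite andbT; exact/eqP.
have G2 : germ x (fun D => frame D [:: r'; r; b * g; b * h]).
  apply: (germ_frame mu) => /=; move: nr nr'; rewrite !inE !negb_or.
  move=> /and4P[_ _ -> ->] /and5P[-> _ _ -> ->] /=; rewrite andbT; apply/eqP.
  by move=> /full_inj.
apply: germ_imp (germ_and G1 G2) => D cD [fr fr'] DA.
have gh' : apart D g h by exact: apart_sub gh.
have rr' : apart D r' r by exact: (fr 0%N 1%N isT).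
have bgh : apart D (b * g) (b * h) by exact: (fr' 2%N 3%N isT).
have sV e f : apart D e f -> (swap D e f)^-1 = swap D e f.
  by move=> ef; apply: (mulIg (swap D e f)); rewrite mulVg swapK.
have -> : swap D g h * b * (swap D g h)^-1 * b^-1 =
    (swap D r' r * swap D g h)^-1 * (swap D r' r * swap D (b * g) (b * h)).
  rewrite invgM !sV// -[RHS]mulgA (mulgA (swap D r' r)) swapK// mul1g.
  by rewrite -swapJ// !mulgA.
apply: alt_mul; last exact: double_swap.
by apply: alt_inv; exact: double_swap.
Qed.

Lemma commutator_alt a b : alt setT (a * b * a^-1 * b^-1).
Proof.
pose C a b := alt setT (a * b * a^-1 * b^-1).
have CM b' f g : C f b' -> C g b' -> C (f * g) b'.
  move=> cf cg; rewrite /C.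
  have -> : f * g * b' * (f * g)^-1 * b'^-1 =
      f * (g * b' * g^-1 * b'^-1) * f^-1 * (f * b' * f^-1 * b'^-1).
    by rewrite invgM !mulgA mulgVK mulgVK.
  by apply: alt_mul => //; exact: altTJ.
have CV b' f : C f b' -> C f^-1 b'.
  move=> /alt_inv /(altTJ f^-1); rewrite /C !invgM !invgK !mulgA.
  by rewrite mulgVK.
have Csym f g : C f g -> C g f.
  by move=> /alt_inv; rewrite /C !invgM !invgK !mulgA.
have Cs A g h b' : clopen A -> apart A g h -> C (swap A g h) b'.
  exact: swap_commutator.
have Cu f : C f (gen u).
  apply: (@full_generated (fun f => C f (gen u))) => //.
  - by move=> ? ?; exact: CM.
  - by move=> ?; exact: CV.
  - by rewrite /C mulgK mulgV; exact: alt1.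
  - by move=> *; exact: Cs.
apply: (@full_generated (fun f => C f b)) => //.
- by move=> ? ?; exact: CM.
- by move=> ?; exact: CV.
- exact: Csym.
- by move=> *; exact: Cs.
Qed.

(** The group is abelian modulo alt setT, and each 3-cycle s t, with s and t swaps
sharing a level, is the inverse of its square, which is the commutator of s and
t. *)
Lemma derived_setE f : derived_set F f <-> alt setT f.
Proof.
split.
  move=> Df; apply: Df; split.
    split; first by rewrite inE; exact: alt1.
    move=> x y; rewrite !inE => ax ay.
    by apply: alt_mul => //; exact: alt_inv.
  move=> z [x [y ->]].
  have := commutator_alt x^-1 y^-1.
  by rewrite !invgK commgEl /conjg !mulgA.
have := derived_set_closed F => -[D1 DB].
have DV g : derived_set F g -> derived_set F g^-1.
  by move=> Dg; have := DB 1 g D1; rewrite !inE mul1g; apply.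
have DM g h : derived_set F g -> derived_set F h -> derived_set F (g * h).
  by move=> Dg /DV Dh; have := DB g h^-1; rewrite !inE invgK; apply.
elim=> [|c g [A [a [b [d [T _ ->]]]]] _ Dg]; first by move: D1; rewrite inE.
apply: DM => //; rewrite -[cyc A a b d]invgK -cyc_sqr//; apply: DV.
move=> S [_ SC]; apply: SC; exists (swap A a b), (swap A b d).
have [cA ab bd _] := T.
have sV g' h : apart A g' h -> (swap A g' h)^-1 = swap A g' h.
  by move=> gh; apply: (mulIg (swap A g' h)); rewrite mulVg swapK.
by rewrite commgEl /conjg !sV// /cyc !mulgA.
Qed.

(** With w the first-return map to a small Y, the element (w g h)(h g 1) coincides
with w on Y: the point y goes to h(y) and then to w(y). *)
Lemma alt_infinite_order V : clopen V -> V !=set0 ->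
  exists2 t : F, alt V t & forall n : nat, (0 < n)%N -> t ^+ n <> 1.
Proof.
move=> cV V0; have oV : open V by case: cV.
have [x Vx] := V0.
have [g Vg ng] := fresh_element mu x [:: x] oV V0.
have [h Vh nh] := fresh_element mu x [:: g x; x] oV V0.
have G1 : germ x (fun D => frame D [:: h; g; 1]).
  apply: (germ_frame mu); rewrite map_cons cons_uniq nh map_cons cons_uniq ng.
  by [].
have := germ_and G1 (germ_and (germ_clopen cV Vx)
  (germ_and (germ_clopen (clopen_preimage g cV) Vg) (germ_clopen (clopen_preimage h cV) Vh))).
move=> /germ_witness [Y [cY Yx [fr [YV [YVg YVh]]]]].
have [w rw] : exists w, is_return Y w by apply: return_exists => //; exists x.
have wY y : Y y -> Y (w y).
  by move=> Yy; have [m [_ _ []]] := return_in cY rw Yy.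
have T1 : tri Y h g 1 by exact: frame_tri.
have T2 : tri Y w g h.
  split=> // [y z Yy Yz|y z Yy Yz|y z Yy Yz].
  - by apply: nesym; apply: (fr 1%N 2%N isT) => //; exact: wY.
  - by apply: nesym; apply: (fr 0%N 1%N isT).
  - by apply: nesym; apply: (fr 0%N 2%N isT) => //; exact: wY.
exists (cyc Y w g h * cyc Y h g 1).
  apply: alt_mul; apply: alt_cyc3.
    by exists Y, w, g, h; split=> // y Yy; split; [exact/YV/wY|exact: YVg|exact: YVh].
  by exists Y, h, g, 1; split=> // y Yy; split; [exact: YVh|exact: YVg|exact: YV].
set t := _ * _ => n n0 tn1.
have tE y : Y y -> t y = w y.
  move=> Yy; have [_ _ k3 _] := cycP T1; have [_ _ l3 _] := cycP T2.
  by rewrite /t fullM (k3 y Yy) l3.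
have Ht (i : nat) : (0 < i)%N -> exists m : nat,
    [/\ (0 < m)%N, (t ^+ i) x = T (Posz m) x & Y ((t ^+ i) x)].
  elim: i => // -[|i] IHi _.
    by have [m [m0 wx _]] := return_in cY rw Yx; exists m; rewrite expg1 tE//; split=> //; exact: wY.
  have [//|m [m0 tm Ym]] := IHi.
  have [m' [m0' wx _]] := return_in cY rw Ym.
  exists (m' + m)%N; rewrite expgS fullM tE//; split; [lia| |exact: wY].
  by rewrite wx {1}tm -zexpgDE.
have [m [m0 + _]] := Ht n n0; rewrite tn1 => /esym /(gen_free mu) /eqP; lia.
Qed.

End Generation.

(** * Commuting maps on an orbit *)
Lemma pigeonhole (f : nat -> nat) n : (forall i, (i <= n)%N -> (f i < n)%N) ->
  exists i j, [/\ (i < j)%N, (j <= n)%N & f i = f j].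
Proof.
move=> fn; apply: contrapT => H.
pose g (i : 'I_n.+1) : 'I_n := Ordinal (fn i (ltn_ord i)).
have gi : injective g.
  move=> i j /(congr1 val) /= fij; apply: val_inj => /=.
  have [ij|ij|//] := ltngtP i j; exfalso; apply: H.
    by exists i, j; split=> //; rewrite -ltnS.
  by exists j, i; split=> //; rewrite -ltnS.
by have := leq_card g gi; rewrite !card_ord ltnn.
Qed.

Section OrbitCounting.
Variables (X : topologicalType) (u : homeo X) (mu : cantor_minimal u).
Notation F := (full_group u).
Notation T n := (zexpg (gen u) n).
Implicit Types (f g h s t : F) (x y z : X).

Lemma full_power g x : exists n : int, g x = T n x.
Proof. by have [n gn] := full_local g x; exists n; exact: nbhs_singleton gn. Qed.

Lemma expg_mul f (m n : nat) x : (f ^+ (m + n)%N) x = (f ^+ m) ((f ^+ n) x).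
Proof. by rewrite expgnDr. Qed.

Lemma commute_fun f g x : f * g = g * f -> f (g x) = g (f x).
Proof. by move=> fg; rewrite -!fullM fg. Qed.

Lemma commute_exp f g (n : nat) : f * g = g * f -> f ^+ n * g = g * f ^+ n.
Proof. by move=> fg; apply/esym/commuteX; exact/esym. Qed.

Lemma commute_zexpg f g (n : int) : f * g = g * f -> zexpg f n * g = g * zexpg f n.
Proof.
move=> fg; case: n => n /=; first exact: commute_exp.
by apply/esym/commuteV/commuteX; exact/esym.
Qed.

Lemma infinite_orbit_inj t z : (forall n : nat, (0 < n)%N -> (t ^+ n) z <> z) ->
  injective (fun n : nat => (t ^+ n) z).
Proof.
move=> inf; suff H i j : (i < j)%N -> (t ^+ i) z <> (t ^+ j) z.
  move=> i j /= E; have [ij|ij|//] := ltngtP i j; first by case: (H _ _ ij).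
  by case: (H _ _ ij).
move=> ij; rewrite -(subnKC (ltnW ij)) expg_mul => /full_inj /esym.
by apply: inf; rewrite subn_gt0.
Qed.

(** On the u-orbit of z, identified with the integers, t moves points by at most c.
The t-orbits of the points h^k(z) are infinite, hence unbounded, so each of
them meets the set N < |i| <= N + c for N large.  This set has 2c elements, so
two of the first 2c + 1 orbits coincide. *)
Lemma infinite_orbits_meet t : exists M : nat, forall h z, h * t = t * h ->
  (forall n : nat, (0 < n)%N -> (t ^+ n) z <> z) ->
  exists k : nat, [/\ (0 < k)%N, (k <= M)%N & exists n : int, (h ^+ k) z = zexpg t n z].
Proof.
have [c Hc] := displacement_bounded mu t.
exists (c + c)%N => h z ht inf.
have [p pE] : exists p : nat -> nat -> int, forall k n, (t ^+ n) ((h ^+ k) z) = T (p k n) z.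
  have [p pE] := choice (fun kn : nat * nat => full_power (t ^+ kn.2 * h ^+ kn.1) z).
  by exists (fun k n => p (k, n)) => k n; rewrite -(pE (k, n)).
have pS k n : (`|(p k n.+1 - p k n)%R| <= c)%N.
  have [d dc td] := Hc (T (p k n) z).
  suff -> : (p k n.+1 - p k n)%R = d by [].
  apply/eqP; rewrite GRing.subr_eq; apply/eqP; apply: (zexpg_gen_inj mu (x := z)).
  by rewrite /= zexpgDE -td -!pE expgS.
have pinj k : injective (p k).
  move=> i j E.
  have inf' n : (0 < n)%N -> (t ^+ n) ((h ^+ k) z) <> (h ^+ k) z.
    move=> n0; rewrite commute_fun; last exact/esym/commute_exp/esym/commute_exp.
    by move=> /full_inj; exact: inf.
  by apply: (infinite_orbit_inj inf') => /=; rewrite !pE E.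
have punb k N : exists n, (N < `|p k n|)%N.
  apply: contrapT => H.
  have bd n : (`|p k n| <= N)%N by rewrite leqNgt; apply/negP => ?; apply: H; exists n.
  have [i|i [j [ij _ E]]] := @pigeonhole (fun n => `|(p k n + Posz N)%R|%N) (N + N).+1.
    by move=> _; have := bd i; lia.
  suff : i = j by lia.
  by apply: (pinj k); have := bd i; have := bd j; lia.
pose N := \max_(k < (c + c).+1) `|p k 0|%N.
have pN k : (k <= c + c)%N -> (`|p k 0| <= N)%N.
  move=> kc; rewrite -ltnS in kc.
  exact: (@leq_bigmax _ (fun k : 'I_(c + c).+1 => `|p k 0|%N) (Ordinal kc)).
(* the first time beyond N, where a step of length at most c has just been made *)
have [r rE] : exists r : nat -> nat, forall k, (k <= c + c)%N ->
    (N < `|p k (r k)|)%N && (`|p k (r k)| <= N + c)%N.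
  suff /choice [r rE] : forall k, exists n, (k <= c + c)%N ->
      (N < `|p k n|)%N && (`|p k n| <= N + c)%N by exists r.
  move=> k; have [kc|kc] := leqP k (c + c); last by exists 0%N.
  case: (ex_minnP (punb k N)) => n Nn Hn; exists n => _; rewrite Nn /=.
  case: n Nn Hn => [|n] Nn Hn; first by have := pN k kc; lia.
  have : (`|p k n| <= N)%N by rewrite leqNgt; apply/negP => /Hn; rewrite ltnn.
  by have := pS k n; lia.
(* an injective numbering of the 2c integers i with N < |i| <= N + c *)
pose code (v : int) := if (0 < v)%R then (`|v| - N.+1)%N else (c + (`|v| - N.+1))%N.
have [k kc|i [j [ij jc E]]] := @pigeonhole (fun k => code (p k (r k))) (c + c).
  by have := rE k kc; rewrite /code; case: ifP; lia.
have {}E : p i (r i) = p j (r j).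
  have ic : (i <= c + c)%N by lia.
  by have := rE i ic; have := rE j jc; move: E; rewrite /code; case: ifP; case: ifP; lia.
exists (j - i)%N; split; [lia|lia|exists (Posz (r i) - Posz (r j))%R].
have := congr1 (fun n => T n z) E; rewrite /= -!pE.
have -> : (h ^+ j) z = (h ^+ i) ((h ^+ (j - i)%N) z).
  by rewrite -expg_mul subnKC// ltnW.
move=> E'.
apply: (@full_inj _ _ (h ^+ i)).
have hz n : h ^+ i * zexpg t n = zexpg t n * h ^+ i.
  by apply/esym/commute_zexpg/esym/commute_exp.
rewrite [RHS](commute_fun _ (hz _)) GRing.addrC zexpgDE.
rewrite -[zexpg t (Posz (r i))]/(t ^+ r i) E' -[t ^+ r j]/(zexpg t (Posz (r j))).
by rewrite -zexpgDE GRing.addNr.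
Qed.

(** A factorial is divisible by all the exponents that can occur, which makes the
exponent independent of h and z. *)
Lemma power_in_orbit t : exists2 M : nat, (0 < M)%N & forall h z, h * t = t * h ->
  (forall n : nat, (0 < n)%N -> (t ^+ n) z <> z) ->
  exists n : int, (h ^+ M) z = zexpg t n z.
Proof.
have [M HM] := infinite_orbits_meet t; exists M`!; first exact: fact_gt0.
move=> h z ht inf; have [k [k0 kM [n hk]]] := HM h z ht inf.
have /dvdnP [q ->] : (k %| M`!)%N by apply: dvdn_fact; rewrite k0.
elim: q => [|q [m IHq]]; first by exists 0%R.
exists (m + n)%R; rewrite mulSn expg_mul IHq zexpgDE -hk commute_fun//.
by apply/commute_exp/esym/commute_zexpg/esym.
Qed.

End OrbitCounting.

(** * Fixed points of the alternating groups *)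
Section Action.
Variables (X1 X2 : topologicalType) (u1 : homeo X1) (u2 : homeo X2).
Hypotheses (mu1 : cantor_minimal u1) (mu2 : cantor_minimal u2).
Notation F1 := (full_group u1).
Notation F2 := (full_group u2).
Variable R : F1 -> F2.
Hypothesis RM : forall f g, alt setT f -> alt setT g -> R (f * g) = R f * R g.
Implicit Types (f g h s t : F1) (A B U V W : set X1) (x p : X1) (y z : X2).

Lemma altT U f : alt U f -> alt setT f.
Proof. exact: alt_sub. Qed.

Lemma hom1 : R 1 = 1.
Proof.
apply: (mulgI (R 1)); rewrite -RM ?mulg1//; exact: alt1.
Qed.

Lemma homV f : alt setT f -> R f^-1 = (R f)^-1.
Proof.
by move=> af; apply: (mulgI (R f)); rewrite -RM ?mulgV ?hom1//; exact: alt_inv.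
Qed.

Lemma homMy f g y : alt setT f -> alt setT g -> R (f * g) y = R f (R g y).
Proof. by move=> af ag; rewrite RM. Qed.

Lemma homX f (n : nat) : alt setT f -> alt setT (f ^+ n) /\ R (f ^+ n) = R f ^+ n.
Proof.
move=> af; elim: n => [|n [an IHn]]; first by rewrite !expg0 hom1; split=> //; exact: alt1.
by rewrite !expgS RM// IHn; split=> //; exact: alt_mul.
Qed.

Lemma hom_commute f g : alt setT f -> alt setT g -> f * g = g * f ->
  R f * R g = R g * R f.
Proof. by move=> af ag fg; rewrite -!RM// fg. Qed.

Definition fixes U y := forall f, alt U f -> R f y = y.

Lemma fixes_sub U V y : U `<=` V -> fixes V y -> fixes U y.
Proof. by move=> UV fV f /(alt_sub UV); exact: fV. Qed.

Lemma fixes0 U y : ~ (U !=set0) -> fixes U y.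
Proof.
move=> U0 f af; suff -> : f = 1 by rewrite hom1.
by apply: full_ext => x; apply: (alt_out af) => Ux; apply: U0; exists x.
Qed.

(** Simplicity, in the form used for actions: the elements of alt U whose images
have the property P along the orbit of y form a normal subgroup. *)
Lemma alt_kernel U y (P : F2 -> X2 -> Prop) f : clopen U ->
  (forall w, P 1 w) ->
  (forall f g h, alt U f -> alt U g -> alt U h ->
     P (R f) (R h y) -> P (R g) (R h y) -> P (R f * R g) (R h y)) ->
  (forall f h, alt U f -> alt U h -> P (R f) (R h y) -> P (R f)^-1 (R h y)) ->
  (forall f k h, alt U f -> alt U k -> alt U h ->
     P (R f) (R k^-1 (R h y)) -> P (R k * R f * (R k)^-1) (R h y)) ->
  alt U f -> f <> 1 -> (forall h, alt U h -> P (R f) (R h y)) ->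
  forall g h, alt U g -> alt U h -> P (R g) (R h y).
Proof.
move=> cU P1 PM PV PJ af f1 Pf.
pose N g := alt U g /\ forall h, alt U h -> P (R g) (R h y).
suff H g : alt U g -> N g by move=> g h /H [_ Pg] ah; exact: Pg.
apply: (@alt_simple _ _ mu1 U N f) => //.
- by split; [exact: alt1|move=> h _; rewrite hom1].
- move=> a b [aa Na] [ab Nb]; split; first exact: alt_mul.
  move=> h ah; rewrite (RM (altT aa) (altT ab)); by apply: PM; auto.
- move=> a [aa Na]; split; first exact: alt_inv.
  by move=> h ah; rewrite (homV (altT aa)); apply: PV; auto.
- move=> k a ak [aa Na]; split; first exact: alt_conj.
  have akV := alt_inv ak.
  move=> h ah; rewrite (RM (alt_mul (altT ak) (altT aa)) (altT akV)).
  rewrite (RM (altT ak) (altT aa)) (homV (altT ak)).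
  apply: PJ => //; rewrite -(homMy _ (altT akV) (altT ah)).
  by apply: Na; exact: alt_mul.
Qed.

(** First, alt U preserves each t-orbit in the orbit of z, because a power of an
element of infinite order does.  Then alt U acts there by translations, which
commute; as alt U is not abelian, simplicity makes the action trivial. *)
Lemma commuting_fixes U t z : clopen U -> alt setT t ->
  (forall f, alt U f -> f * t = t * f) ->
  (forall n : nat, (0 < n)%N -> (R t ^+ n) z <> z) -> fixes U z.
Proof.
move=> cU at_ Ut inf.
have [U0|] := pselect (U !=set0); last exact: fixes0.
have [s as_ s_inf] := alt_infinite_order mu1 cU U0.
have [M M0 HM] := power_in_orbit mu2 (R t).
have Rt f : alt U f -> R f * R t = R t * R f.
  by move=> af; apply: hom_commute; [exact: altT af|exact: at_|exact: Ut].
have infh h n : alt U h -> (0 < n)%N -> (R t ^+ n) (R h z) <> R h z.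
  move=> ah n0; rewrite commute_fun; last exact/commute_exp/esym/Rt.
  by move=> /full_inj; exact: inf.
(* a power of s preserves the t-orbits, and it is not the identity *)
have sX := homX M (altT as_).
have sM1 : s ^+ M <> 1 by exact: s_inf.
have asM : alt U (s ^+ M).
  by elim: M {HM M0 sX sM1} => [|M IH]; [exact: alt1|rewrite expgS; exact: alt_mul].
have H1 : forall g h, alt U g -> alt U h -> exists n : int, R g (R h z) = zexpg (R t) n (R h z).
  apply: (@alt_kernel U z (fun (r : F2) w => exists n : int, r w = zexpg (R t) n w) (s ^+ M)) => //.
  - by move=> w; exists 0%R.
  - move=> f g h af ag ah [m fm] [n gn]; exists (n + m)%R.
    rewrite fullM gn zexpgDE -fm commute_fun//.
    by apply/esym/commute_zexpg/esym/Rt.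
  - move=> f h af ah [m fm]; exists (- m)%R; apply: (@full_inj _ _ (R f)).
    rewrite fullVK -commute_fun; last exact/commute_zexpg/esym/Rt.
    by rewrite fm -zexpgDE GRing.addNr.
  - move=> f k h af ak ah [m fm]; exists m.
    rewrite !fullM -(homV (altT ak)) fm -commute_fun; last exact/commute_zexpg/esym/Rt.
    by rewrite (homV (altT ak)) fullVK.
  - move=> h ah; rewrite sX.2; apply: HM; first exact: Rt.
    by move=> n n0; exact: infh.
have [f [g [af ag fg1]]] : exists f g, [/\ alt U f, alt U g & f * g * f^-1 * g^-1 <> 1].
  apply: contrapT => H; apply: (s_inf 1%N) => //; rewrite expg1.
  apply: (@alt_perfect _ _ mu1 U (fun f => f = 1)) => //.
    by move=> f g -> ->; rewrite mulg1.
  by move=> f g af ag; apply: contrapT => fg; apply: H; exists f, g; split.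
have afg : alt U (f * g * f^-1 * g^-1).
  by apply: alt_mul; [exact: alt_conj|exact: alt_inv].
have H2 : forall g h, alt U g -> alt U h -> R g (R h z) = R h z.
  apply: (@alt_kernel U z (fun (r : F2) w => r w = w) (f * g * f^-1 * g^-1)) => //.
  - by move=> a b h _ _ _ Ea Eb; rewrite fullM Eb.
  - by move=> a h _ _ Ea; rewrite -{1}Ea fullKV.
  - by move=> a k h aa ak ah; rewrite (homV (altT ak)) !fullM => ->; rewrite fullVK.
  move=> h ah; have [m fm] := H1 f h af ah; have [n gn] := H1 g h ag ah.
  have -> : R (f * g * f^-1 * g^-1) = R f * R g * (R f)^-1 * (R g)^-1.
    have [aF aG] := (altT af, altT ag).
    have aFG := alt_mul aF aG.
    rewrite (RM (alt_mul aFG (alt_inv aF)) (alt_inv aG)) (RM aFG (alt_inv aF)).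
    by rewrite (RM aF aG) (homV aF) (homV aG).
  have zC k : alt U k -> forall i : int, zexpg (R t) i * R k = R k * zexpg (R t) i.
    by move=> ak i; exact/commute_zexpg/esym/Rt.
  rewrite !fullM.
  have gV : (R g)^-1 (R h z) = zexpg (R t) (- n)%R (R h z).
    apply: (@full_inj _ _ (R g)); rewrite fullVK -(commute_fun _ (zC g ag _)) gn.
    by rewrite -zexpgDE GRing.addNr.
  have fV : (R f)^-1 (R h z) = zexpg (R t) (- m)%R (R h z).
    apply: (@full_inj _ _ (R f)); rewrite fullVK -(commute_fun _ (zC f af _)) fm.
    by rewrite -zexpgDE GRing.addNr.
  rewrite gV -(homV (altT af)) -(commute_fun _ (zC _ (alt_inv af) _)) (homV (altT af)) fV.
  rewrite -zexpgDE -(commute_fun _ (zC g ag _)) gn -zexpgDE.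
  rewrite -(commute_fun _ (zC f af _)) fm -zexpgDE.
  suff -> : (- n - m + n + m = 0)%R by []. lia.
by move=> k ak; have := H2 k 1 ak (alt1 _ U); rewrite hom1.
Qed.

(** Suppose alt V moves y, and let t in alt V have infinite order.  If all t-orbits
on the closure C of the orbit of y under alt V were finite, some power of t
would act trivially on C by compactness, and so would alt V by simplicity.  At a
point z of C with an infinite t-orbit, alt (~` V) fixes z; each of its elements
then fixes some point of the orbit of y near z, hence y, by commutation. *)
Lemma fixes_clopen_or_complement V y : clopen V -> fixes V y \/ fixes (~` V) y.
Proof.
move=> cV; have [|nf] := pselect (fixes V y); [by left|right].
have V0 : V !=set0 by apply: contrapT => V0; apply: nf; exact: fixes0.
have [t at_ t_inf] := alt_infinite_order mu1 cV V0.
pose C := closure [set w | exists2 h, alt V h & w = R h y].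
have [z [Cz inf]] : exists z, C z /\ forall n : nat, (0 < n)%N -> (R t ^+ n) z <> z.
  apply: contrapT => H; apply: nf.
  have [|||z Cz|A CA [n n0 An]] := @compact_ideal X2 C (fun A : set X2 => exists2 n : nat, (0 < n)%N &
      forall z, A z -> (R t ^+ n) z = z).
  - apply: (subclosed_compact _ (cantor_minimal_compact mu2)) => //.
    exact: closed_closure.
  - by exists 1%N.
  - move=> A B [n n0 An] [m m0 Bm]; exists (n * m)%N; first by rewrite muln_gt0 n0.
    have fixX (f : F2) w (i : nat) : f w = w -> (f ^+ i) w = w.
      by move=> fw; elim: i => // i IH; rewrite expgS fullM IH.
    move=> z [/An|/Bm] E; last by rewrite mulnC expgnA; exact: fixX.
    by rewrite expgnA; exact: fixX.
  - have [n [n0 nz]] : exists n : nat, (0 < n)%N /\ (R t ^+ n) z = z.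
      apply: contrapT => Hn; apply: H; exists z; split=> // n n0 nz.
      by apply: Hn; exists n.
    exists [set w | (R t ^+ n) w = (1 : F2) w]; split=> //; last by exists n.
    by have [] := full_eq_clopen mu2 (R t ^+ n) 1.
  move=> f af.
  have atn : alt V (t ^+ n).
    by elim: n {n0 An} => [|m IH]; [exact: alt1|rewrite expgS; exact: alt_mul].
  suff H2 : forall g h, alt V g -> alt V h -> R g (R h y) = R h y.
    by have := H2 f 1 af (alt1 _ V); rewrite hom1.
  apply: (@alt_kernel V y (fun (r : F2) w => r w = w) (t ^+ n)) => //.
  - by move=> a b h _ _ _ Ea Eb; rewrite fullM Eb.
  - by move=> a h _ _ Ea; rewrite -{1}Ea fullKV.
  - by move=> a k h aa ak ah; rewrite (homV (altT ak)) !fullM => ->; rewrite fullVK.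
  - exact: t_inf.
  - move=> h ah; rewrite (homX n (altT at_)).2; apply: An; apply: CA.
    by apply: subset_closure; exists h.
move=> g ag.
have Vg h : alt V h -> R g * R h = R h * R g.
  move=> ah; apply: hom_commute; [exact: altT ag|exact: altT ah|].
  by apply: (alt_commute ag ah); rewrite setICl.
have fz : R g z = z.
  apply: (@commuting_fixes (~` V) t) => //; first exact: clopenC.
    exact: altT at_.
  by move=> f af; apply: (alt_commute af at_); rewrite setICl.
have [oG _] := full_eq_clopen mu2 (R g) 1.
have [w [[h ah ->] /= E]] := Cz _ (open_nbhs_nbhs (conj oG fz)).
apply: (@full_inj _ _ (R h)).
by rewrite -(commute_fun _ (Vg h ah)).
Qed.

Lemma clopen_split U : clopen U -> U !=set0 ->
  exists A, [/\ clopen A, A `<=` U, A !=set0 & (U `&` ~` A) !=set0].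
Proof.
move=> cU [x Ux].
have [|V [_ [x' Vx'] VU Vx]] := open_avoid mu1 [:: x] cU.1; first by exists x.
have xx' : x' != x by have := Vx _ Vx'; rewrite inE.
have [A [cA Ax' nAx]] := cantor_minimal_zero_dimensional mu1 xx'.
exists (U `&` A); split.
- exact: clopenI.
- by move=> w [].
- by exists x'; split=> //; exact: VU.
- by exists x; split=> // -[].
Qed.

Lemma fixes_meet U V y : clopen U -> clopen V -> U `&` V !=set0 ->
  fixes U y -> fixes V y -> fixes (U `|` V) y.
Proof.
move=> cU cV UV fU fV f af.
suff [] : alt setT f /\ R f y = y by [].
apply: (alt_union mu1 (N := fun f => alt setT f /\ R f y = y) cU cV UV _ _ _ _ af).
- by split; [exact: alt1|rewrite hom1].
- by move=> g h [ag gy] [ah hy]; split; [exact: alt_mul|rewrite homMy// hy].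
- by move=> g ag; split; [exact: altT ag|exact: fU].
- by move=> g ag; split; [exact: altT ag|exact: fV].
Qed.

(** When U and V are disjoint, choose W such that W and ~` W both meet U and V.
By the alternative, the group of W or that of ~` W fixes y; either set meets both U
and V, and links them. *)
Lemma fixes_union U V y : clopen U -> clopen V ->
  fixes U y -> fixes V y -> fixes (U `|` V) y.
Proof.
move=> cU cV fU fV.
have [UV|UV] := pselect (U `&` V !=set0); first exact: fixes_meet.
have [U0|U0] := pselect (U !=set0); last first.
  by apply: fixes_sub fV => x [Ux|//]; exfalso; apply: U0; exists x.
have [V0|V0] := pselect (V !=set0); last first.
  by apply: fixes_sub fU => x [//|Vx]; exfalso; apply: V0; exists x.
have [A [cA AU A0 UA]] := clopen_split cU U0.
have [B [cB BV B0 VB]] := clopen_split cV V0.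
have key W : clopen W -> W `&` U !=set0 -> W `&` V !=set0 -> fixes W y ->
    fixes (U `|` V) y.
  move=> cW WU WV fW; apply: (@fixes_sub _ ((W `|` U) `|` V)).
    by move=> x [Ux|Vx]; [left; right|right].
  apply: fixes_meet => //; [exact: clopenU| |exact: fixes_meet].
  by have [x [Wx Vx]] := WV; exists x; split=> //; left.
have cAB : clopen (A `|` B) by exact: clopenU.
have [fW|fW] := fixes_clopen_or_complement y cAB.
  apply: (key _ cAB) => //.
    by have [x Ax] := A0; exists x; split; [left|exact: AU].
  by have [x Bx] := B0; exists x; split; [right|exact: BV].
have cW : clopen (~` (A `|` B)) by exact: clopenC.
apply: (key _ cW) => //.
  have [x [Ux nAx]] := UA; exists x; split=> // -[//|Bx].
  by apply: UV; exists x; split=> //; exact: BV.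
have [x [Vx nBx]] := VB; exists x; split=> // -[Ax|//].
by apply: UV; exists x; split=> //; exact: AU.
Qed.

(** * The point of the source system below a moved point *)

(** The filter of clopen neighbourhoods of x is read off the action at y; x will
be the image of y under the factor map. *)
Definition lies_over x y := forall V, clopen V -> V x -> ~ fixes V y.

(** Otherwise the clopen sets U with alt U fixing y would form an ideal that
contains a neighbourhood of each point. *)
Lemma lies_over_exists y : ~ fixes setT y -> exists x, lies_over x y.
Proof.
move=> ny; apply: contrapT => H; apply: ny.
have [||A B [cA fA] [cB fB]|x _|A TA [_ fA]] :=
    @compact_ideal X1 setT (fun A => clopen A /\ fixes A y).
- exact: cantor_minimal_compact mu1.
- by split; [exact: clopen0|apply: fixes0 => -[]].
- by split; [exact: clopenU|exact: fixes_union].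
- apply: contrapT => Hx; apply: H; exists x => V cV Vx fV.
  by apply: Hx; exists V; split=> //; case: cV.
- exact: fixes_sub fA.
Qed.

Lemma lies_over_fixes x y V : lies_over x y -> clopen V -> ~ V x -> fixes V y.
Proof.
move=> xy cV nVx; have [//|fV] := fixes_clopen_or_complement y cV.
by case: (xy (~` V) _ nVx fV); exact: clopenC.
Qed.

Lemma lies_over_uniq x x' y : lies_over x y -> lies_over x' y -> x = x'.
Proof.
move=> xy xy'; apply: contrapT => /eqP xx'.
have [V [cV Vx Vx']] := cantor_minimal_zero_dimensional mu1 xx'.
by apply: (xy V cV Vx); exact: lies_over_fixes xy' cV Vx'.
Qed.

Lemma lies_over_equivariant x y f : lies_over x y -> alt setT f ->
  lies_over (f x) (R f y).
Proof.
move=> xy af V cV Vx fV; apply: (xy (f @^-1` V)) => //.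
  exact: clopen_preimage.
move=> g ag; have agT := altT ag.
have fgV : alt V (f * g * f^-1).
  by apply: alt_sub (altJ f ag) => w /=; rewrite /mkset fullVK.
have := fV _ fgV; rewrite RM ?RM ?homV//; [|exact: alt_mul|exact: alt_inv].
by rewrite !fullM fullKV => /full_inj.
Qed.


Lemma lies_over_moves x y f : lies_over x y -> alt setT f -> f x <> x -> R f y <> y.
Proof.
move=> xy af fx E; have := lies_over_equivariant xy af; rewrite E => H.
by apply: fx; exact: lies_over_uniq H xy.
Qed.

Definition cyc_supp A (a b c : F1) :=
  [set x | A (a^-1 x)] `|` [set x | A (b^-1 x)] `|` [set x | A (c^-1 x)].

Lemma cyc_suppP A (a b c : F1) x : cyc_supp A a b c x ->
  exists2 x', A x' & [\/ x = a x', x = b x' | x = c x'].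
Proof.
case=> [[]|] /= Ax; [exists (a^-1 x)|exists (b^-1 x)|exists (c^-1 x)] => //;
  rewrite fullVK; by [constructor 1|constructor 2|constructor 3].
Qed.

Lemma cyc_fixes A (a b c : F1) x y : lies_over x y -> tri A a b c ->
  (forall x', A x' -> [/\ x <> a x', x <> b x' & x <> c x']) ->
  R (cyc A a b c) y = y.
Proof.
move=> xy T nx; have [cA _ _ _] := T.
have cS : clopen (cyc_supp A a b c) by do 2?apply: clopenU; exact: clopen_level.
have nS : ~ cyc_supp A a b c x.
  by move=> /cyc_suppP [x' /nx [n1 n2 n3] [|/n2|/n3]].
apply: (lies_over_fixes xy cS nS); apply: alt_cyc3; exists A, a, b, c; split=> //.
by move=> x' Ax'; split; [left; left|left; right|right]; rewrite /mkset fullKV.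
Qed.

(** Rotating and reparametrizing the levels makes the first one a neighbourhood of
p, on which the second label may be taken to be c itself. *)
Lemma cyc3_local_form (c : F1) p : cyc3 setT c -> c p <> p ->
  exists (f : F1) A0, [/\ clopen A0, A0 p, tri A0 1 c f & c = cyc A0 1 c f].
Proof.
move=> [A [a [b [d [T _ cE]]]]] cp.
suff H (a' b' d' : F1) : tri A a' b' d' -> c = cyc A a' b' d' -> (exists2 x, A x & p = a' x) ->
    exists (f : F1) A0, [/\ clopen A0, A0 p, tri A0 1 c f & c = cyc A0 1 c f].
  have [ha|na] := level_cases A a p; first exact: H T cE ha.
  have [hb|nb] := level_cases A b p.
    by apply: (H b d a) => //; [exact: tri_rot|rewrite cE cyc_rot].
  have [hd|nd] := level_cases A d p.
    have T' := tri_rot T.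
    by apply: (H d a b) => //; [exact: tri_rot|rewrite cE cyc_rot// cyc_rot].
  case: cp; rewrite cE; have [_ _ _ ->//] := cycP T.
  by move=> x Ax; split; [exact: na|exact: nb|exact: nd].
move=> {T cE}T cE [x Ax px].
have T1 := tri_reparam a'^-1 T.
have [k1 _ _ _] := cycP T.
have loc (z : X1) : [set z | A (a'^-1 z)] z ->
    [/\ (a' * a'^-1) z = (1 : F1) z, (b' * a'^-1) z = c z & (d' * a'^-1) z = (d' * a'^-1) z].
  move=> Az; have {}Az : A (a'^-1 z) := Az; split; last by [].
    by rewrite fullM fullVK.
  by rewrite cE fullM -{2}(fullVK a' z) k1.
have [cA ab bd ad] := T1.
have T2 : tri [set z | A (a'^-1 z)] 1 c (d' * a'^-1).
  split=> // [z w Az Aw|z w Az Aw|z w Az Aw].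
  - by have [<- _ _] := loc z Az; have [_ <- _] := loc w Aw; exact: ab.
  - by have [_ <- _] := loc z Az; exact: bd.
  - by have [<- _ _] := loc z Az; exact: ad.
exists (d' * a'^-1), [set z | A (a'^-1 z)]; split=> //.
  by rewrite /mkset px fullKV.
by rewrite {1}cE (cyc_reparam a'^-1 T); exact: cyc_local.
Qed.

Lemma cyc_germ A A' (c f : F1) p y : lies_over p y -> tri A 1 c f ->
  clopen A' -> A' `<=` A -> A' p -> R (cyc A 1 c f) y = R (cyc A' 1 c f) y.
Proof.
move=> py T cA' A'A A'p; have [cA ab bc ac] := T.
have cA'' : clopen (A `&` ~` A') by apply: clopenI => //; exact: clopenC.
have AE : A = A' `|` (A `&` ~` A').
  by rewrite setUIr setUv setIT (setUidr A'A).
have T' : tri A' 1 c f by exact: tri_sub T.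
have T'' : tri (A `&` ~` A') 1 c f by apply: tri_sub T => // ? [].
have a1 : alt setT (cyc A' 1 c f) by apply: alt_cyc3; exists A', 1, c, f.
have a2 : alt setT (cyc (A `&` ~` A') 1 c f).
  by apply: alt_cyc3; exists (A `&` ~` A'), 1, c, f.
rewrite {1}AE cycU//; last 2 first.
- by rewrite setICA setICr setI0.
- by rewrite -AE.
rewrite homMy// [R (cyc (A `&` _) 1 c f) y](cyc_fixes py T'')// => x [Ax nAx].
by split; [move=> E; apply: nAx; rewrite -[x]/((1 : F1) x) -E|
  apply: (ab p x) => //; exact: A'A|apply: (ac p x) => //; exact: A'A].
Qed.

(** Near p the two 3-cycles are (1 c f) and (1 c f'), up to factors that live away
from p.  Their quotient (1 c f)^-1 (1 c f') = (f c f') avoids p as well. *)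
Lemma cyc3_determined (c c' : F1) p y : lies_over p y -> cyc3 setT c -> cyc3 setT c' ->
  c p = c' p -> c p <> p -> R c y = R c' y.
Proof.
move=> py hc hc' cc' cp.
have [f [A [cA Ap T cE]]] := cyc3_local_form hc cp.
have c'p : c' p <> p by rewrite -cc'.
have [f' [A' [cA' A'p T' cE']]] := cyc3_local_form hc' c'p.
have G1 := germ_and (germ_clopen cA Ap) (germ_and (germ_clopen cA' A'p) (germ_eq mu1 cc')).
have key B : clopen B -> B p -> B `<=` A -> B `<=` A' -> (forall x, B x -> c x = c' x) ->
    [/\ tri B 1 c f, tri B 1 c f', R c y = R (cyc B 1 c f) y & R c' y = R (cyc B 1 c f') y].
  move=> cB Bp BA BA' Bcc'.
  have TB := tri_sub cB BA T; have TB' := tri_sub cB BA' T'.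
  have TB'' : tri B 1 c f'.
    have [_ ab bc ac] := TB'; split=> //.
    - by have [] := TB.
    - by move=> x x' Bx Bx'; rewrite Bcc'//; exact: bc.
  split=> //.
  - by rewrite {1}cE; exact: (cyc_germ py T cB BA Bp).
  - rewrite {1}cE' (cyc_germ py T' cB BA' Bp).
    by congr (R _ y); apply/esym/cyc_local => // x Bx; split=> //; exact: Bcc'.
have [ff|nff] := pselect (f p = f' p).
  have [B [cB Bp [[BA [BA' Bcc]] Bff]]] := germ_witness (germ_and G1 (germ_eq mu1 ff)).
  have [T1 T2 -> ->] := key B cB Bp BA BA' Bcc.
  by congr (R _ y); apply: cyc_local => // x Bx; split=> //; exact: Bff.
have [B [cB Bp [[BA [BA' Bcc]] Bff]]] := germ_witness (germ_and G1 (germ_apart mu1 nff)).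
have [T1 T2 -> ->] := key B cB Bp BA BA' Bcc.
have [_ s1c scf s1f] := T1; have [_ _ scf' s1f'] := T2.
have T3 : tri B f c f' by split=> //; exact: apart_sym.
have E : cyc B 1 c f' = cyc B 1 c f * cyc B f c f'.
  rewrite {2 3}/cyc -(swapC cB scf) -mulgA (mulgA (swap B c f)) swapK// mul1g.
  by [].
have aT (a b d : F1) : tri B a b d -> alt setT (cyc B a b d).
  by move=> Tt; apply: alt_cyc3; exists B, a, b, d.
rewrite E homMy; [|exact: aT|exact: aT].
congr (R _ _); apply/esym/(cyc_fixes py T3) => x Bx; split.
- exact: s1f.
- exact: s1c.
- exact: s1f'.
Qed.

Lemma cyc3_exists p (k k' : F1) : p <> k p -> p <> k' p -> k p <> k' p ->
  exists c : F1, [/\ cyc3 setT c, c p = k p, c (k p) = k' p & c (k' p) = p].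
Proof.
move=> n1 n2 n3.
have us : uniq [seq g p | g <- [:: 1; k; k'] : seq F1].
  rewrite /= !inE !negb_or !andbT; apply/andP; split; last exact/eqP.
  by apply/andP; split; exact/eqP.
have [B [cB Bp fr]] := germ_witness (germ_frame mu1 us).
have TT := frame_tri cB fr; have [c1 c2 c3 _] := cycP TT.
exists (cyc B 1 k k'); split; [|exact: (c1 p)|exact: c2|exact: (c3 p)].
by exists B, 1, k, k'.
Qed.

Lemma cyc3_exists2 p (k : F1) : k p <> p -> exists2 c : F1, cyc3 setT c & c p = k p.
Proof.
move=> kp.
have [k' _ nk'] := fresh_element mu1 p [:: p; k p] openT (ex_intro _ p I).
move: nk'; rewrite !inE negb_or => /andP[/eqP n1 /eqP n2].
have [|||c [hc cp _ _]] := @cyc3_exists p k k'; try exact/nesym.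
by exists c.
Qed.

(** Induction on a word in 3-cycles: the image of y under a word g depends only on
g p.  A last letter that sends p' to p'', three distinct points p, p', p'' being
involved, may be replaced by the 3-cycle p -> p' -> p'' -> p, whose square is its
inverse. *)
Lemma stabilizer_word p y g : lies_over p y -> alt setT g ->
  (g p = p -> R g y = y) /\
  (forall c : F1, cyc3 setT c -> c p = g p -> g p <> p -> R g y = R c y).
Proof.
move=> py; elim=> [|c1 g' hc1 ag' [IH1 IH2]]; first by rewrite hom1.
have a1 := alt_cyc3 hc1.
have fix_cyc x z c : lies_over x z -> cyc3 setT c -> c x = x -> R c z = z.
  move=> xz [A [a [b [d [T _ ->]]]]] cx; apply: (cyc_fixes xz T) => x' Ax'.
  have [k1 k2 k3 _] := cycP T; have [_ ab bd ad] := T.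
  split=> E; move: cx; rewrite E.
  - by rewrite k1// => /esym; exact: ab.
  - by rewrite k2// => /esym; exact: bd.
  - by rewrite k3//; exact: ad.
have py' := lies_over_equivariant py ag'.
rewrite fullM homMy//.
have [gp|gp] := pselect (g' p = p).
  rewrite gp IH1//; split; first exact: fix_cyc.
  by move=> c hc cp c1p; apply: (cyc3_determined py) => //; rewrite cp.
have [c0 hc0 c0p] := cyc3_exists2 gp.
have g'y := IH2 c0 hc0 c0p gp.
have [c1g|c1g] := pselect (c1 (g' p) = g' p).
  by rewrite (fix_cyc _ _ _ py' hc1 c1g) c1g; split.
have [c1p|c1p] := pselect (c1 (g' p) = p).
  split=> [_|c _ _]; last by rewrite c1p.
  rewrite (IH2 c1^-1) //; first by rewrite homV// fullVK.
    exact: cyc3V.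
  by rewrite -{1}c1p fullKV.
have [|||c2 [hc2 c2p c2g c2c]] := @cyc3_exists p g' (c1 * g').
- exact/nesym.
- exact/nesym.
- exact/nesym.
have a2 := alt_cyc3 hc2.
split; first by [].
move=> c hc cp _.
rewrite (cyc3_determined py' hc1 hc2)//.
rewrite (IH2 c2)// -homMy//.
have -> : c2 * c2 = c2^-1.
  by have [A [a [b [d [T _ ->]]]]] := hc2; exact: cyc_sqr.
have c2V : c2^-1 p = c1 (g' p) by rewrite -{1}c2c fullKV.
by apply: (cyc3_determined py); [exact: cyc3V|exact: hc|rewrite cp|rewrite c2V].
Qed.

Lemma stabilizer p y g : lies_over p y -> alt setT g -> g p = p -> R g y = y.
Proof. by move=> py ag; exact: (stabilizer_word py ag).1. Qed.

End Action.

(** * Extending the action to the full group *)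
Section Extension.
Variables (X1 X2 : topologicalType) (u1 : homeo X1) (u2 : homeo X2).
Hypotheses (mu1 : cantor_minimal u1) (mu2 : cantor_minimal u2).
Notation F1 := (full_group u1).
Notation F2 := (full_group u2).
Notation T n := (zexpg (gen u1) n).
Variable R : F1 -> F2.
Hypothesis RM : forall f g, alt setT f -> alt setT g -> R (f * g) = R f * R g.
Implicit Types (c d f g h k : F1) (A U V W : set X1) (x p : X1) (y z : X2).

Definition moved y := exists x, lies_over R x y.

Lemma alt_transport k x : exists2 c : F1, alt setT c & c x = k x.
Proof.
have [kx|kx] := pselect (k x = x); first by exists 1; [exact: alt1|rewrite kx].
by have [c hc cx] := cyc3_exists2 mu1 kx; exists c => //; exact: alt_cyc3.
Qed.

(** Elements of the full group move a point of X1 in the same way as elements of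
the alternating group, and only the image of the point below y matters; so the
action extends from alt setT to the full group. *)
Definition act k y : X2 := xget y [set y' | exists x (c : F1),
  [/\ lies_over R x y, alt setT c, c x = k x & y' = R c y]].

Lemma actE k x y c : lies_over R x y -> alt setT c -> c x = k x -> act k y = R c y.
Proof.
move=> xy ac cx.
have [x' [c' [xy' ac' cx' ->]]] : exists x' (c' : F1),
    [/\ lies_over R x' y, alt setT c', c' x' = k x' & act k y = R c' y].
  apply: (@xgetPex _ y [set y' | exists x (c : F1),
    [/\ lies_over R x y, alt setT c, c x = k x & y' = R c y]]).
  by exists (R c y), x, c.
have xx := lies_over_uniq mu1 mu2 RM xy' xy; subst x'.
have aV := alt_inv ac; have aa := alt_mul aV ac'.
have := stabilizer mu1 mu2 RM xy aa.
rewrite fullM cx' -cx fullKV => /(_ erefl); rewrite RM// fullM homV// => E.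
by rewrite -{2}E fullVK.
Qed.

Lemma act_out k y : ~ moved y -> act k y = y.
Proof. by move=> ny; rewrite /act xgetPN// => z [x [c [xy _ _ _]]]; apply: ny; exists x. Qed.

Lemma act_lies k x y : lies_over R x y -> lies_over R (k x) (act k y).
Proof.
move=> xy; have [c ac cx] := alt_transport k x.
by rewrite (actE xy ac cx) -cx; exact: lies_over_equivariant.
Qed.

Lemma actM k h y : act (k * h) y = act k (act h y).
Proof.
have [[x xy]|ny] := pselect (moved y); last by rewrite !act_out.
have [c ac cx] := alt_transport h x; have [d ad dx] := alt_transport k (h x).
rewrite (actE xy ac cx).
have xy' : lies_over R (h x) (R c y) by rewrite -cx; exact: lies_over_equivariant.
rewrite (actE xy' ad dx) (actE (c := d * c) xy (alt_mul ad ac)); first by rewrite RM.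
by rewrite fullM cx dx.
Qed.

Lemma act1 y : act 1 y = y.
Proof.
have [[x xy]|ny] := pselect (moved y); last by rewrite act_out.
by rewrite (actE (c := 1) xy (alt1 _ _))// hom1.
Qed.

(** Finitely many elements of alt setT move all the points of X1; a point of X2 is
moved as soon as one of their images moves it. *)
Lemma moved_clopen : clopen [set y | moved y].
Proof.
have [||A B [B1 [c1 m1 H1]] [B2 [c2 m2 H2]]|x _|A TA [B [cB mB HB]]] :=
    @compact_ideal X1 setT (fun A => exists B : set X2, [/\ clopen B,
      forall y, B y -> moved y & forall x y, A x -> lies_over R x y -> B y]).
- exact: cantor_minimal_compact mu1.
- by exists set0; split=> //; exact: clopen0.
- exists (B1 `|` B2); split; first exact: clopenU.
  + by move=> y [/m1|/m2].
  + by move=> x y [Ax|Bx] xy; [left; exact: H1 xy|right; exact: H2 xy].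
- have [k _ nk] := fresh_element mu1 x [:: x] openT (ex_intro _ x I).
  have kx : k x <> x by move: nk; rewrite inE => /eqP.
  have [c ac cx] := alt_transport k x.
  have cA := clopenC set0 (full_eq_clopen mu1 c 1).
  have cB := clopenC set0 (full_eq_clopen mu2 (R c) 1).
  exists (~` [set x | c x = (1 : F1) x]); split.
  + by case: cA.
  + by rewrite /= cx.
  exists (~` [set y | R c y = (1 : F2) y]); split=> //.
  + move=> y cy; apply: (lies_over_exists mu1 mu2 RM) => fy.
    by apply: cy; exact: (fy _ ac).
  + by move=> x' y nx xy; exact: (lies_over_moves mu1 mu2 RM xy ac nx).
rewrite (_ : [set y | moved y] = B)//; apply/seteqP; split=> y; last exact: mB.
by move=> [x xy]; apply: HB xy; exact: TA.
Qed.

Lemma lies_over_nearby V x y : clopen V -> lies_over R x y -> V x ->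
  exists O, [/\ open O, O y & forall z, O z -> exists2 x', lies_over R x' z & V x'].
Proof.
move=> cV xy Vx.
have [f [af fy]] : exists f : F1, alt V f /\ R f y <> y.
  apply: contrapT => H; apply: (xy V cV Vx) => f af; apply: contrapT => fy.
  by apply: H; exists f.
have cB := clopenC set0 (full_eq_clopen mu2 (R f) 1).
exists (~` [set y | R f y = (1 : F2) y]); split=> //; first by case: cB.
move=> z fz; have [|x' x'z] := @lies_over_exists _ _ _ _ mu1 mu2 R RM z.
  by move=> fix_z; apply: fz; exact: (fix_z f (altT af)).
exists x' => //; apply: contrapT => nV; apply: fz.
exact: (lies_over_fixes mu1 mu2 RM x'z cV nV af).
Qed.

Lemma act_full k : exists f : F2, forall y, f y = act k y.
Proof.
apply: (@full_paste _ u2 (act k) (act k^-1)).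
- by move=> y; rewrite -actM mulVg act1.
- by move=> y; rewrite -actM mulgV act1.
move=> y; have [[x xy]|ny] := pselect (moved y); last first.
  exists 1, (~` [set y | moved y]); split=> //.
    by apply: closed_openC; case: moved_clopen.
  by move=> z; exact: act_out.
have [c ac cx] := alt_transport k x.
have [O [oO Oy HO]] := lies_over_nearby (full_eq_clopen mu1 c k) xy cx.
exists (R c), O; split=> // z /HO [x' x'z cx'].
exact: actE x'z ac cx'.
Qed.

(** The set of points below moved points is closed, by compactness of the set of
moved points, and it contains a dense orbit. *)
Lemma over_surjective : (exists y, moved y) -> forall x, exists y, lies_over R x y.
Proof.
move=> [y0 [x0 xy0]] x; apply: contrapT => nx.
have [||A B [V [cV Vx HV]] [W [cW Wx HW]]|y [x' x'y]|A MA [V [cV Vx HV]]] :=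
    @compact_ideal X2 [set y | moved y] (fun A : set X2 => exists V, [/\ clopen V, V x &
      forall y x', A y -> lies_over R x' y -> ~ V x']).
- apply: (subclosed_compact _ (cantor_minimal_compact mu2)) => //.
  by case: moved_clopen.
- by exists setT; split=> //; exact: clopenT.
- exists (V `&` W); split=> //; first exact: clopenI.
  by move=> y x' [Ay|By] xy [Vx' Wx']; [exact: HV Ay xy Vx'|exact: HW By xy Wx'].
- have /eqP xx' : x' <> x by move=> E; apply: nx; exists y; rewrite -E.
  have [V [cV Vx' nVx]] := cantor_minimal_zero_dimensional mu1 xx'.
  have [O [oO Oy HO]] := lies_over_nearby cV x'y Vx'.
  exists O; split=> //; exists (~` V); split=> //; first exact: clopenC.
  move=> z x'' Oz x''z; have [w wz Vw] := HO z Oz.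
  by rewrite (lies_over_uniq mu1 mu2 RM x''z wz).
have oV : open V by case: cV.
have [n Vn] := orbit_dense mu1 x0 oV (ex_intro _ x Vx).
have H := @act_lies (T n) _ _ xy0.
by apply: (HV (act (T n) y0) _ _ H Vn); apply: MA; exists (T n x0).
Qed.

Lemma zexpg_act (v : F2) (n : int) y : (forall y, v y = act (gen u1) y) -> zexpg v n y = act (T n) y.
Proof.
move=> vE; have vV z : v^-1 z = act (gen u1)^-1 z.
  by apply: (@full_inj _ _ v); rewrite fullVK vE -actM mulgV act1.
have E (m : nat) z : (v ^+ m) z = act (gen u1 ^+ m) z.
  elim: m z => [|m IH] z; first by rewrite !expg0 act1.
  by rewrite !expgS fullM actM IH vE.
case: n => n /=; first exact: E.
by apply: (@full_inj _ _ (v ^+ n.+1)); rewrite fullVK E -actM mulgV act1.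
Qed.

Lemma hom_extension : exists v : F2,
  [/\ forall x y, lies_over R x y -> lies_over R (gen u1 x) (v y),
      forall y, moved y <-> v y <> y &
      forall (g : F1) x y (n : int), alt setT g -> lies_over R x y -> g x = T n x ->
        R g y = zexpg v n y].
Proof.
have [v vE] := act_full (gen u1); exists v; split.
- by move=> x y xy; rewrite vE; exact: act_lies.
- move=> y; split; last first.
    by move=> vy; apply: contrapT => ny; apply: vy; rewrite vE act_out.
  move=> [x xy] vy; have := @act_lies (gen u1) _ _ xy; rewrite -vE vy => xy'.
  by have /(gen_free mu1 (n := 1%R)) := lies_over_uniq mu1 mu2 RM xy' xy.
- by move=> g x y n ag xy gx; rewrite (zexpg_act _ _ vE) (actE xy ag gx).
Qed.

End Extension.

(** * Homomorphisms induced by factor maps *)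
Lemma set_type_nbhs (X : topologicalType) (A : set X) (s : A) (U : set A) :
  nbhs s U <-> exists O, [/\ open O, O (val s) & forall s' : A, O (val s') -> U s'].
Proof.
split.
  rewrite nbhsE => -[W [[O oO OW] Ws] WU]; exists O; split=> //.
    by move: Ws; rewrite -OW.
  by move=> s' Os'; apply: WU; rewrite -OW.
move=> [O [oO Os OU]]; rewrite nbhsE; exists (@set_val _ A @^-1` O) => //.
  by split=> //; exists O.
Qed.

Lemma multiplicative_ext (G H : groupType) (r r' : {multiplicative G -> H}) :
  r =1 r' -> r = r'.
Proof.
case: r r' => [f [[fM]]] [f' [[fM']]] /= /funext ff; subst f'.
by rewrite (Prop_irrelevance fM fM').
Qed.

Section Support.
Variables (X : topologicalType) (u : homeo X) (mu : cantor_minimal u).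
Notation F := (full_group u).

Lemma suppE (v : F) : supp v = [set x | v x <> x].
Proof.
have [_ cl] := clopenC set0 (full_eq_clopen mu v 1).
have E : [set x | v x <> x] = [set x | v x != x].
  by apply/seteqP; split=> x /= /eqP.
by rewrite /supp -E; apply/esym/closure_id.
Qed.

Lemma cocycleP (g : F) x : g x = zexpg (gen u) (orbit_cocycle u g x) x.
Proof.
have Fg : is_full u g by have /set_mem := valP g.
by have [_ ->] := orbit_cocycleP mu Fg; rewrite zexpgE.
Qed.

Lemma cocycle_unique (g : F) x (n : int) : g x = zexpg (gen u) n x -> orbit_cocycle u g x = n.
Proof. by rewrite {1}cocycleP => /(zexpg_gen_inj mu). Qed.

End Support.

Section Induced.
Variables (X1 X2 : topologicalType) (u1 : homeo X1) (u2 : homeo X2).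
Hypotheses (mu1 : cantor_minimal u1) (mu2 : cantor_minimal u2).
Notation F1 := (full_group u1).
Notation F2 := (full_group u2).
Notation T n := (zexpg (gen u1) n).
Variables (v : F2) (q : supp v -> X1).
Hypothesis fq : factor_map (@supp_map X2 v) u1 q.
Implicit Types (g h : F1) (s : supp v) (y : X2).

Lemma supp_moved s : v (val s) <> val s.
Proof.
have H y : supp v y -> v y <> y by rewrite (suppE mu2).
exact/H/set_mem/valP.
Qed.

Lemma mem_suppP y : v y <> y -> y \in supp v.
Proof. by move=> vy; rewrite inE (suppE mu2). Qed.

Lemma factor_step s s' : val s' = v (val s) -> q s' = gen u1 (q s).
Proof.
move=> ss'; have [_ _ /(congr1 (fun f => f s)) /= ->] := fq.
by congr q; apply: val_inj.
Qed.

Lemma supp_zexpg s (n : int) : exists2 s' : supp v, val s' = zexpg v n (val s) & q s' = T n (q s).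
Proof.
elim/int_rect: n => [|n [s' E1 E2]|n [s' E1 E2]]; first by exists s.
  have Hm : v (v (val s')) <> v (val s') by move=> /full_inj; exact: supp_moved.
  exists (exist _ (v (val s')) (mem_suppP Hm)).
    change (v (val s') = zexpg v (Posz n.+1) (val s)).
    by rewrite E1 -addn1 PoszD GRing.addrC zexpgDE.
  rewrite (@factor_step s')// E2 -addn1 PoszD GRing.addrC.
  by rewrite zexpgDE.
have Hm : v (v^-1 (val s')) <> v^-1 (val s').
  by rewrite fullVK => E; apply: (@supp_moved s'); rewrite {1}E fullVK.
exists (exist _ (v^-1 (val s')) (mem_suppP Hm)).
  change (v^-1 (val s') = zexpg v (- Posz n.+1)%R (val s)).
  by rewrite E1 -addn1 PoszD GRing.opprD GRing.addrC zexpgDE.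
apply: (@full_inj _ _ (gen u1)); rewrite -(@factor_step _ s'); last first.
  by change (val s' = v (v^-1 (val s'))); rewrite fullVK.
rewrite E2; transitivity (T (1 + - Posz n.+1)%R (q s)); last by rewrite zexpgDE.
by congr (T _ _); lia.
Qed.

(** The orbits of v over the support project onto infinite orbits of u1. *)
Lemma supp_free s (n m : int) : zexpg v n (val s) = zexpg v m (val s) -> n = m.
Proof.
have [s1 E1 Q1] := supp_zexpg s n; have [s2 E2 Q2] := supp_zexpg s m.
move=> E; apply: (zexpg_gen_inj mu1 (x := q s)) => /=.
by rewrite -Q1 -Q2; congr q; apply: val_inj; rewrite E1 E2.
Qed.

(** Stated as a choice over points of the support, so that q is only applied where
it is defined. *)
Definition induced g y : X2 := xget y [set y' | exists s : supp v,
  y = val s /\ y' = zexpg v (orbit_cocycle u1 g (q s)) y].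

Lemma inducedE g s : induced g (val s) = zexpg v (orbit_cocycle u1 g (q s)) (val s).
Proof.
have [s' [ss' ->]] : exists s' : supp v, val s = val s' /\
    induced g (val s) = zexpg v (orbit_cocycle u1 g (q s')) (val s).
  apply: (@xgetPex _ (val s) [set y' | exists s' : supp v,
    val s = val s' /\ y' = zexpg v (orbit_cocycle u1 g (q s')) (val s)]).
  by exists (zexpg v (orbit_cocycle u1 g (q s)) (val s)), s.
by rewrite (val_inj ss').
Qed.

Lemma induced_out g y : ~ supp v y -> induced g y = y.
Proof.
move=> ny; rewrite /induced xgetPN// => z [s [ys _]]; apply: ny.
by rewrite ys; exact/set_mem/valP.
Qed.

Lemma supp_cases y : (exists s : supp v, y = val s) \/ ~ supp v y.
Proof.
have [sy|ny] := pselect (supp v y); [left|by right].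
by exists (exist _ y (mem_set sy)).
Qed.

Lemma inducedM g h y : induced (g * h) y = induced g (induced h y).
Proof.
have [[s ->]|ny] := supp_cases y; last by rewrite !induced_out.
have [s' E Q] := supp_zexpg s (orbit_cocycle u1 h (q s)).
rewrite (inducedE h) -E !inducedE E -zexpgDE; congr (zexpg v _ _).
apply: (cocycle_unique mu1).
by rewrite fullM (cocycleP mu1 h) -Q (cocycleP mu1 g) Q -zexpgDE.
Qed.

Lemma induced1 y : induced 1 y = y.
Proof.
have [[s ->]|ny] := supp_cases y; last by rewrite !induced_out.
by rewrite inducedE (cocycle_unique mu1 (n := 0%R)).
Qed.

Lemma induced_full g : exists f : F2, forall y, f y = induced g y.
Proof.
apply: (@full_paste _ u2 (induced g) (induced g^-1)).
- by move=> y; rewrite -inducedM mulVg induced1.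
- by move=> y; rewrite -inducedM mulgV induced1.
have cS : clopen (supp v).
  by rewrite (suppE mu2); exact: (clopenC set0 (full_eq_clopen mu2 v 1)).
move=> y; have [[s ->]|ny] := supp_cases y; last first.
  exists 1, (~` supp v); split=> //; first by apply: closed_openC; case: cS.
  by move=> z; exact: induced_out.
have [cq _ _] := fq.
have [n gn] := full_local g (q s).
have /set_type_nbhs [O [oO Os HO]] := cq s _ gn.
exists (zexpg v n), (supp v `&` O); split.
- by apply: openI => //; case: cS.
- by split=> //; exact/set_mem/valP.
move=> z [sz Oz]; pose s' : supp v := exist _ z (mem_set sz).
have {}Oz : O (val s') by [].
rewrite -[z]/(val s') inducedE; congr (zexpg v _ _).
apply: (cocycle_unique mu1); exact: HO Oz.
Qed.

Lemma induced_hom : exists r : {multiplicative F1 -> F2},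
  forall g y, r g y = induced g y.
Proof.
have [r rE] := choice induced_full.
have rM : {morph r : g h / g * h >-> g * h}.
  by move=> g h; apply: full_ext => y; rewrite fullM !rE inducedM.
pose r' : {multiplicative F1 -> F2} := HB.pack r (isMultiplicative.Build F1 F2 r rM).
by exists r'.
Qed.

Lemma induced_faithful g : (forall y, induced g y = y) -> g = 1.
Proof.
move=> Hg; apply: full_ext => x; have [_ sq _] := fq.
have [s _ <-] : range q x by rewrite sq.
rewrite (cocycleP mu1) (_ : orbit_cocycle u1 g (q s) = 0%R)//.
apply: (@supp_free s); rewrite -inducedE Hg.
by [].
Qed.

End Induced.

(** * Homomorphisms and pairs *)
Section Homomorphisms.
Variables (X1 X2 : topologicalType) (u1 : homeo X1) (u2 : homeo X2).
Hypotheses (mu1 : cantor_minimal u1) (mu2 : cantor_minimal u2).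
Notation F1 := (full_group u1).
Notation F2 := (full_group u2).
Notation D1 := (derived_group F1).

Lemma alt_derived (g : F1) : alt setT g -> exists d : D1, derived_val d = g.
Proof.
move=> /(derived_setE mu1) /mem_set dg; by exists (DerivedGroup dg).
Qed.

Lemma derived_alt (d : D1) : alt setT (derived_val d).
Proof. by apply/(derived_setE mu1); have /set_mem := valP d. Qed.

Lemma hom_factor (rho : {multiplicative D1 -> F2}) : nontrivial_hom rho ->
  exists p : {v : F2 & supp v -> X1},
    factor_map (@supp_map X2 (projT1 p)) u1 (projT2 p) /\ induced_by (projT2 p) rho.
Proof.
move=> [d0 /eqP rd0].
have [R RE] : exists R : F1 -> F2, forall d : D1, R (derived_val d) = rho d.
  have H (g : F1) : exists f : F2, forall d : D1, derived_val d = g -> f = rho d.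
    have [ag|ng] := pselect (alt setT g).
      have [d dg] := alt_derived ag; exists (rho d) => d' dg'.
      by congr (rho _); apply: val_inj => /=; rewrite -[LHS]/(derived_val d) dg.
    by exists 1 => d dg; case: ng; rewrite -dg; exact: derived_alt.
  by have [R RE] := choice H; exists R => d; exact: RE.
have RM f g : alt setT f -> alt setT g -> R (f * g) = R f * R g.
  move=> /alt_derived [d <-] /alt_derived [d' <-].
  by rewrite !RE -gmulfM -RE.
have [v [v1 v2 v3]] := hom_extension mu1 mu2 RM.
have sv : supp v = [set y | moved R y].
  by rewrite (suppE mu2); apply/seteqP; split=> y /= /v2.
have over (s : supp v) : exists x, lies_over R x (val s).
  have H y : supp v y -> moved R y by rewrite sv.
  exact/H/set_mem/valP.
have [q qE] := choice over.
have mv : exists y, moved R y.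
  apply: contrapT => H; apply: rd0; rewrite -RE; apply: full_ext => y.
  apply: contrapT => ny; apply: H; exists y.
  apply: (lies_over_exists mu1 mu2 RM) => fy; apply: ny; apply: fy.
  exact: derived_alt.
exists (existT _ v q); split=> /=; last first.
  move=> g; split=> [s|y ny].
    rewrite -RE; apply: (v3 _ _ _ _ (derived_alt g) (qE s)).
    exact: (cocycleP mu1 (derived_val g)).
  rewrite -RE; apply: contrapT => gy; apply: ny; rewrite sv.
  apply: (lies_over_exists mu1 mu2 RM) => fy; apply: gy; apply: fy.
  exact: derived_alt.
split.
- move=> s A /(clopen_basis mu1) [V [cV Vq VA]]; apply/set_type_nbhs.
  have [O [oO Os HO]] := lies_over_nearby mu1 mu2 RM cV (qE s) Vq.
  exists O; split=> // s' /HO [x xs Vx]; apply: VA.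
  by rewrite (lies_over_uniq mu1 mu2 RM (qE s') xs).
- apply/seteqP; split=> // x _.
  have [y xy] := over_surjective mu1 mu2 RM mv x.
  have sy : supp v y by rewrite sv; exists x.
  pose s : supp v := exist _ y (mem_set sy).
  by exists s => //; exact: (lies_over_uniq mu1 mu2 RM (qE s) xy).
- apply/funext => s /=.
  exact: (lies_over_uniq mu1 mu2 RM (v1 _ _ (qE s)) (qE (supp_map s))).
Qed.

Lemma gen_moves (x : X1) : gen u1 x <> x.
Proof. by move=> /(gen_free mu1 (n := 1%R)). Qed.

(** The exponent vanishes exactly at the fixed points of d, as both systems are
free. *)
Lemma induced_by_moved (v : F2) (q : supp v -> X1) (rho : D1 -> F2) (d : D1) (s : supp v) :
  factor_map (@supp_map X2 v) u1 q -> induced_by q rho ->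
  rho d (val s) = val s <-> derived_val d (q s) = q s.
Proof.
move=> fq /(_ d) [/(_ s) -> _]; split=> E.
  rewrite (cocycleP mu1) (_ : orbit_cocycle u1 (derived_val d) (q s) = 0%R)//.
  exact: (supp_free mu1 mu2 fq (s := s)).
by rewrite (cocycle_unique mu1 (n := 0%R)).
Qed.

Lemma induced_by_supp (v : F2) (q : supp v -> X1) (rho : D1 -> F2) y :
  factor_map (@supp_map X2 v) u1 q -> induced_by q rho ->
  supp v y <-> exists d, rho d y <> y.
Proof.
move=> fq iq; split=> [sy|[d dy]]; last first.
  by apply: contrapT => ny; apply: dy; exact: (iq d).2.
pose s : supp v := exist _ y (mem_set sy).
have [g ag gx] := alt_transport mu1 (gen u1) (q s); have [d dg] := alt_derived ag.
exists d; rewrite -[y]/(val s) => /(induced_by_moved _ _ fq iq).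
by rewrite dg gx; exact: gen_moves.
Qed.

(** The homomorphism determines the support, as the set of moved points; the map
q, since a 3-cycle around q(s) that avoids q'(s) would move s for one pair and fix
it for the other; and v, through an element of D with cocycle 1 at q(s). *)
Lemma induced_by_unique (p p' : {v : F2 & supp v -> X1}) (rho : D1 -> F2) :
  factor_map (@supp_map X2 (projT1 p)) u1 (projT2 p) -> induced_by (projT2 p) rho ->
  factor_map (@supp_map X2 (projT1 p')) u1 (projT2 p') -> induced_by (projT2 p') rho ->
  p = p'.
Proof.
case: p p' => [v q] [v' q'] /= fq iq fq' iq'.
have sE y : supp v y <-> supp v' y.
  by rewrite (induced_by_supp _ fq iq) (induced_by_supp _ fq' iq').
have qE (s : supp v) (s' : supp v') : val s = val s' -> q s = q' s'.
  move=> ss'; apply: contrapT => /eqP qq'.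
  have [V [cV Vq nVq']] := cantor_minimal_zero_dimensional mu1 qq'.
  have [g Vg ng] := fresh_element mu1 (q s) [:: q s] (proj1 cV) (ex_intro _ _ Vq).
  have [h Vh nh] := fresh_element mu1 (q s) [:: g (q s); q s] (proj1 cV) (ex_intro _ _ Vq).
  have us : uniq [seq (f : F1) (q s) | f <- [:: h; g; 1]].
    by rewrite map_cons cons_uniq nh map_cons cons_uniq ng.
  have [B [cB Bq [fr [BV [Bg Bh]]]]] := germ_witness (germ_and (germ_frame mu1 us)
    (germ_and (germ_clopen cV Vq) (germ_and (germ_clopen (clopen_preimage g cV) Vg)
      (germ_clopen (clopen_preimage h cV) Vh)))).
  have TT := frame_tri cB fr.
  have ac : cyc3 V (cyc B h g 1).
    by exists B, h, g, 1; split=> // x Bx; split; [exact: Bh|exact: Bg|exact: BV].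
  have [d dg] := alt_derived (altT (alt_cyc3 ac)).
  have E' : derived_val d (q' s') = q' s' by rewrite dg; exact: cyc3_out ac nVq'.
  move: E' => /(induced_by_moved _ _ fq' iq'); rewrite -ss'.
  move=> /(induced_by_moved _ _ fq iq); rewrite dg.
  have [_ _ k3 _] := cycP TT.
  rewrite -{1}[q s]/((1 : F1) (q s)) k3// => E.
  by have := fr 0%N 2%N isT (q s) (q s) Bq Bq; rewrite /= E.
have vE : v = v'.
  apply: full_ext => y; have [sy|nsy] := pselect (supp v y); last first.
    have nsy' : ~ supp v' y by move=> /sE.
    move: nsy nsy'; rewrite !(suppE mu2) /= => n1 n2.
    by rewrite (contrapT n1) (contrapT n2).
  pose s : supp v := exist _ y (mem_set sy).
  pose s' : supp v' := exist _ y (mem_set (proj1 (sE y) sy)).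
  have ss' : q s = q' s' by exact: qE.
  have [g ag gx] := alt_transport mu1 (gen u1) (q s); have [d dg] := alt_derived ag.
  have E1 := (iq d).1 s; have E2 := (iq' d).1 s'.
  have C1 : orbit_cocycle u1 (derived_val d) (q s) = 1%R.
    by apply: (cocycle_unique mu1); rewrite dg gx.
  rewrite -ss' C1 in E2; rewrite C1 in E1.
  by rewrite -[v y]/(zexpg v 1%R (val s)) -E1 E2.
subst v'; congr existT; apply/funext => s; exact: qE.
Qed.

End Homomorphisms.

Theorem theorem10p2 (X1 X2 : topologicalType) (u1 : homeo X1) (u2 : homeo X2)
    (min1 : cantor_minimal u1) (min2 : cantor_minimal u2) :
  [/\ (exists rho : {multiplicative derived_group (full_group u1) -> full_group u2},
         injective rho) <->
      (exists rho : {multiplicative full_group u1 -> full_group u2},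
         injective rho),
      (exists rho : {multiplicative full_group u1 -> full_group u2},
         injective rho) <->
      (exists v : full_group u2, factors_onto (@supp_map X2 v) u1),
      (forall (v : full_group u2) (q : supp v -> X1),
         factor_map (@supp_map X2 v) u1 q ->
         exists! rho : {multiplicative derived_group (full_group u1) -> full_group u2},
           nontrivial_hom rho /\ induced_by q rho)
    & (forall rho : {multiplicative derived_group (full_group u1) -> full_group u2},
         nontrivial_hom rho ->
         exists! p : {v : full_group u2 & supp v -> X1},
           factor_map (@supp_map X2 (projT1 p)) u1 (projT2 p) /\
           induced_by (projT2 p) rho)].
Proof.
have [x0 _] : exists x0 : X1, True.
  have [[h [_ [h' _]]] _] := min1; by exists (h' (point : cantor_space)).
have [g0 ag0 g0x] := alt_transport min1 (gen u1) x0.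
have [d0 d0g] := alt_derived min1 ag0.
have d01 : d0 <> 1.
  move=> E; apply: (gen_moves min1 (x := x0)).
  by rewrite -g0x -d0g E.
have restrict (rho : {multiplicative full_group u1 -> full_group u2}) :
    exists r : {multiplicative derived_group (full_group u1) -> full_group u2},
      forall d, r d = rho (derived_val d).
  pose f (d : derived_group (full_group u1)) := rho (derived_val d).
  have fM : {morph f : g h / g * h >-> g * h} by move=> g h; exact: gmulfM.
  pose r : {multiplicative derived_group (full_group u1) -> full_group u2} :=
    HB.pack f (isMultiplicative.Build (derived_group (full_group u1)) (full_group u2) f fM).
  by exists r.
have inj_val : injective (@derived_val (full_group u1)) by exact: val_inj.
have i_iii : (exists rho : {multiplicative derived_group (full_group u1) -> full_group u2},
    injective rho) -> exists v : full_group u2, factors_onto (@supp_map X2 v) u1.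
  move=> [rho inj].
  have [|[v q] [fq _]] := hom_factor min1 min2 (rho := rho).
    exists d0; apply/eqP => E; apply: d01; apply: (mulgI d0); apply: inj.
    by rewrite mulg1 gmulfM E mulg1.
  by exists v, q.
have ii_i : (exists rho : {multiplicative full_group u1 -> full_group u2}, injective rho) ->
    exists rho : {multiplicative derived_group (full_group u1) -> full_group u2}, injective rho.
  move=> [rho inj]; have [r rE] := restrict rho; exists r => d d'.
  by rewrite !rE => /inj /inj_val.
have iii_ii : (exists v : full_group u2, factors_onto (@supp_map X2 v) u1) ->
    exists rho : {multiplicative full_group u1 -> full_group u2}, injective rho.
  move=> [v [q fq]]; have [rho rE] := induced_hom min1 min2 fq; exists rho => g h gh.
  suff : g * h^-1 = 1 by move=> /(congr1 (fun k => k * h)); rewrite mulgVK mul1g.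
  apply: (induced_faithful min1 min2 fq) => y.
  rewrite (inducedM min1 min2 fq) -rE gh rE -(inducedM min1 min2 fq) mulgV.
  exact: induced1.
split.
- by split=> [/i_iii/iii_ii|/ii_i].
- by split=> [/ii_i/i_iii|/iii_ii].
- move=> v q fq; have [rho rE] := induced_hom min1 min2 fq.
  have [r rrE] := restrict rho; exists r; split.
    have ir : induced_by q r.
      move=> g; split=> [s|y ny]; rewrite rrE rE; last exact: induced_out.
      exact: inducedE.
    split=> //.
    have [_ sq _] := fq; have [s _ sx] : range q x0 by rewrite sq.
    exists d0; apply/eqP => E.
    have /(induced_by_moved min1 min2 _ _ fq ir) : r d0 (val s) = val s by rewrite E.
    by rewrite d0g sx g0x; exact: gen_moves.
  move=> r' [_ ir']; apply: multiplicative_ext => d; apply: full_ext => y.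
  rewrite rrE rE; have [[s ->]|ny] := supp_cases v y.
    by rewrite inducedE// (ir' d).1.
  by rewrite induced_out// (ir' d).2.
- move=> rho nt; have [p [fp ip]] := hom_factor min1 min2 nt.
  exists p; split=> // p' [fp' ip'].
  exact: (induced_by_unique min1 min2 fp ip fp' ip').
Qed.
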